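(* Let $(R,\mathfrak m)$ be a Cohen-Macaulay local ring with $\dim R=1$. Let $I$ and $J$ be Ulrich ideals of $R$ with $I\subsetneq J$, set $B=J:J$, and let $b\in\mathfrak m$ be such that $J=(b)+I$. Then $\frac{I}{b}$ is an Ulrich ideal of the Cohen-Macaulay local ring $B$ of dimension one, and there is a one-to-one correspondence $\mathfrak a\mapsto\frac{\mathfrak a}{b}$ between the Ulrich ideals $\mathfrak a$ of $R$ such that $I\subseteq\mathfrak a\subsetneq J$ and the Ulrich ideals $\mathfrak b$ of $B$ such that $\frac{I}{b}\subseteq\mathfrak b$.
   Context: Local rings are Noetherian. $\mathrm{Q}(R)$ denotes the total ring of fractions of $R$. For $R$-submodules $X,Y$ of $\mathrm{Q}(R)$, $X:Y=\{x\in \mathrm{Q}(R)\mid xY\subseteq X\}$. For an ideal $\mathfrak a$ of $R$, $\frac{\mathfrak a}{b}=\{\frac{x}{b}\mid x\in\mathfrak a\}=b^{-1}\mathfrak a\subseteq \mathrm{Q}(R)$. For a one-dimensional Cohen-Macaulay local ring $(T,\mathfrak m_T)$ (here $T=R$ or $T=B$), an $\mathfrak m_T$-primary ideal $I$ of $T$ is called an Ulrich ideal of $T$ if it contains a parameter ideal $Q=(a)$ of $T$ as a reduction and satisfies: (1) $I\neq Q$, (2) $I^2=QI$, and (3) $I/I^2$ is a free $T/I$-module. In the setting of the claim one has $J^2=bJ$ (so $b$ is a non-zerodivisor), and $B$ is a one-dimensional Cohen-Macaulay local ring with maximal ideal $\mathfrak n=\mathfrak m+\frac{I}{b}$. *)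

(* Defs.v *)
From HB Require Import structures.
From mathcomp Require Import all_boot all_algebra.
From mathcomp Require Import all_classical.

Set Implicit Arguments.
Unset Strict Implicit.
Unset Printing Implicit Defensive.

Import GRing.Theory.
Local Open Scope classical_set_scope.
Local Open Scope ring_scope.

Section Ideals.
Variable T : comNzRingType.
Implicit Types (I J P m : set T) (a : T) (s : seq T).

Definition is_ideal I : Prop :=
  [/\ I 0, (forall x y, I x -> I y -> I (x + y))
    & (forall r x, I x -> I (r * x))].

Definition ideal_gen (X : set T) : set T := smallest is_ideal X.

Definition principal a : set T := ideal_gen [set a].

Definition ideal_add I J : set T := [set x + y | x in I & y in J].

Definition ideal_mul I J : set T := ideal_gen [set x * y | x in I & y in J].

Definition ideal_pow I (n : nat) : set T := iter n (ideal_mul I) [set: T].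

Definition radical I : set T := [set x | exists n : nat, I (x ^+ n)].

Definition prime_ideal P : Prop :=
  [/\ is_ideal P, ~ P 1 & forall x y, P (x * y) -> P x \/ P y].

Definition maximal_ideal m : Prop :=
  [/\ is_ideal m, ~ m 1
    & forall I, is_ideal I -> ~ I 1 -> m `<=` I -> I = m].

Definition primary_ideal I : Prop :=
  [/\ is_ideal I, ~ I 1 & forall x y, I (x * y) -> I x \/ radical I y].

Definition primary_to m I : Prop := primary_ideal I /\ radical I = m.

Definition noetherian : Prop :=
  forall I, is_ideal I -> exists s, I = ideal_gen [set` s].

(* Local rings are Noetherian by convention. *)
Definition local_ring m : Prop :=
  [/\ noetherian, maximal_ideal m & forall m', maximal_ideal m' -> m' = m].

(* P 0 < P 1 < ... < P n; the values of P beyond n are irrelevant. *)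
Definition prime_chain (P : nat -> set T) (n : nat) : Prop :=
  (forall i, (i <= n)%N -> prime_ideal (P i)) /\
  (forall i, (i < n)%N -> P i `<` P i.+1).

Definition has_krull_dim (d : nat) : Prop :=
  (exists P : nat -> set T, prime_chain P d) /\
  (forall (P : nat -> set T) n, prime_chain P n -> (n <= d)%N).

Definition regular_sequence s : Prop :=
  (forall i, (i < size s)%N -> forall x,
     ideal_gen [set` take i s] (s`_i * x) -> ideal_gen [set` take i s] x) /\
  ~ ideal_gen [set` s] 1.

Definition has_depth m (d : nat) : Prop :=
  (exists s, [/\ regular_sequence s, [set` s] `<=` m & size s = d]) /\
  (forall s, regular_sequence s -> [set` s] `<=` m -> (size s <= d)%N).

Definition cohen_macaulay_local m : Prop :=
  local_ring m /\ exists d, has_krull_dim d /\ has_depth m d.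

Definition parameter_ideal m (q : set T) : Prop :=
  primary_to m q /\
  exists s, has_krull_dim (size s) /\ q = ideal_gen [set` s].

Definition is_reduction (q I : set T) : Prop :=
  q `<=` I /\ exists n : nat, ideal_pow I n.+1 = ideal_mul q (ideal_pow I n).

(* I/I^2 is a free T/I-module: the classes of some x_0, ..., x_(n-1) in I form
   a basis.  The coefficients c are representatives in T of elements of T/I.
   A finite basis is no restriction over a Noetherian T, where I/I^2 is
   finitely generated. *)
Definition conormal_free I : Prop :=
  exists (n : nat) (x : 'I_n -> T),
    [/\ forall i, I (x i),
        forall y, I y -> exists c : 'I_n -> T,
          ideal_pow I 2 (y - \sum_(i < n) c i * x i)
      & forall c : 'I_n -> T,
          ideal_pow I 2 (\sum_(i < n) c i * x i) -> forall i, I (c i)].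

(* Meant for a one-dimensional Cohen-Macaulay local ring (T, m). *)
Definition ulrich_ideal m I : Prop :=
  primary_to m I /\
  exists a, let q := principal a in
    [/\ parameter_ideal m q /\ is_reduction q I,
        I <> q, ideal_pow I 2 = ideal_mul q I & conormal_free I].

End Ideals.

(* (Q, iota) is a localization of R at its nonzerodivisors; GRing.lreg s says
   that multiplication by s is injective. *)
Definition total_fraction_ring (R : comNzRingType) (Q : comUnitRingType)
    (iota : {rmorphism R -> Q}) : Prop :=
  [/\ injective iota,
      forall s : R, GRing.lreg s -> iota s \is a GRing.unit
    & forall x : Q, exists (a s : R), GRing.lreg s /\ x = iota a / iota s].

Definition colon (Q : comNzRingType) (X Y : set Q) : set Q :=
  [set x | forall y, Y y -> X (x * y)].

Definition ideal_frac (R : comNzRingType) (Q : comUnitRingType)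
    (iota : {rmorphism R -> Q}) (a : set R) (b : R) : set Q :=
  [set iota x / iota b | x in a].

Record ideal (R : comNzRingType) := Ideal {
  ideal_set :> set R;
  ideal_setP : is_ideal ideal_set }.

Section ColonRing.
Variables (R : comNzRingType) (Q : comUnitRingType).
Variables (iota : {rmorphism R -> Q}) (J : ideal R).

Definition colon_pred : {pred Q} :=
  [pred x | `[< colon (iota @` J) (iota @` J) x >]].

Fact colon_subring : subring_closed colon_pred.
Proof.
have [_ JD JM] := ideal_setP J.
split=> [|x y /asboolP xJ /asboolP yJ|x y /asboolP xJ /asboolP yJ];
  apply/asboolP => z Jz.
- by rewrite mul1r.
- have [u Ju uE] := xJ _ Jz; have [v Jv vE] := yJ _ Jz.
  exists (u + (-1) * v); first exact/JD/JM.
  by rewrite rmorphD rmorphM rmorphN rmorph1 mulN1r uE vE mulrBl.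
- by rewrite -mulrA; apply/xJ/yJ.
Qed.

HB.instance Definition _ :=
  GRing.isSubringClosed.Build Q colon_pred colon_subring.

Definition colon_ring : Type := {x : Q | x \in colon_pred}.

HB.instance Definition _ := SubChoice.on colon_ring.
HB.instance Definition _ :=
  [SubChoice_isSubComNzRing of colon_ring by <:].

End ColonRing.

(* Main.v *)
Require Import Defs.
From HB Require Import structures.
From mathcomp Require Import all_boot all_algebra.
From mathcomp Require Import all_classical.
From mathcomp Require Import ring.

(** An Ulrich ideal [I] with [I^2 = aI] is [I = aA] for the ring [A = I/a]
between [R] and [Q(R)]; here [A/I] is free over [R/I] on a basis containing
[1], and [I] is the colon [R : A].  In the same way [J = bB] with
[B = J : J = J/b].  The arguments below are about [A] and [B] but are carried
out in [R] by clearing denominators: an element [x] of [A] is represented by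
the element [ax] of [I].

Let [I] and [J] be Ulrich ideals, [I] strictly inside [J], with [J^2 = cJ].
Two facts govern the pair.

- [JI = cI] ([nested_mul]).  Indeed [JI/c] is an [A]-module and lies in
  [J^2/c = J], hence in [R], hence in [R : A = I].  So [B] is contained in [A],
  and freeness of [A/I] over [R/I] gives [J = cR + I] ([nested_span]).
- [I^2 = crI] for some [r] in [R] ([nested_reduction]).  Let [V] be the
  intersection of [I] and [cR].  Freeness of [I/I^2] shows that [a^2] is in [VI], so [V] is not
  contained in [mI].  Two elements [cr1], [cr2] of [V] satisfy the relation
  [r2 (c r1) = r1 (c r2)], so by freeness they cannot be independent modulo
  [mI]; thus [V] is generated modulo [mI] by a single [cr], and Nakayama makes
  [cr] a reduction of [I].

Consequently [I/c = rA] with [r] in [m], and [B = R + rA].  The elements of [rA]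
have their squares in [mB], so that an element of [J] generating [J] modulo [I]
differs from a unit multiple of [c] by something negligible, and can replace [c]
([nested_change]); this applies to [b].

Now let [K = I/b].  Since [B = R + K] and [K] is nilpotent modulo [mB], the
nonunits of [B] are [m + K] and [B] is local.  A prime of [B] other than the
maximal one does not contain [b], and such a prime is recovered from its
contraction because [bB] lies in [R]; so [B] has dimension one, and [b] is
regular.  A basis of [I/I^2] over [R/I] divided by [b] is a basis of [K/K^2] over
[B/K], so [K] is an Ulrich ideal ([overring_ulrich]); every Ulrich ideal
between [I] and [J] may play the part of [I] here.  Conversely, let [C] be an
Ulrich ideal of [B] strictly containing [K].  The two facts, applied to [K] and
[C] in [B], give [C = tB + K] and [K^2 = tuK], where [t] and [u] can be chosen in
[R] because [B = R + K].  Then [bC = (bt)R + I] and [I^2 = btuI]; a basis of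
[I/I^2] containing [btu] becomes a basis of [bC/(bC)^2] when [btu] is replaced by
[bt] ([nested_conormal_free]), whence [bC] is an Ulrich ideal of [R]
([image_ulrich]). *)

Set Implicit Arguments.
Unset Strict Implicit.
Unset Printing Implicit Defensive.

Import GRing.Theory.
Local Open Scope classical_set_scope.
Local Open Scope ring_scope.

(** * Ideals and primes *)

Section IdealCalculus.
Context {T : comNzRingType}.
Implicit Types (I J M N m P : set T) (a b c r x y z : T) (s : seq T).

Lemma ideal0 I : is_ideal I -> I 0. Proof. by case. Qed.

Lemma idealD I x y : is_ideal I -> I x -> I y -> I (x + y).
Proof. by case=> _ + _; apply. Qed.

Lemma ideal_scalel I r x : is_ideal I -> I x -> I (r * x).
Proof. by case=> _ _; apply. Qed.

Lemma ideal_scaler I r x : is_ideal I -> I x -> I (x * r).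
Proof. by rewrite mulrC; apply: ideal_scalel. Qed.

Lemma idealN I x : is_ideal I -> I x -> I (- x).
Proof. by move=> idI Ix; rewrite -mulN1r; apply: ideal_scalel. Qed.

Lemma idealB I x y : is_ideal I -> I x -> I y -> I (x - y).
Proof. by move=> idI Ix Iy; apply: idealD => //; apply: idealN. Qed.

Lemma ideal_sum I (K : Type) (ks : seq K) (p : pred K) (F : K -> T) :
  is_ideal I -> (forall k, p k -> I (F k)) -> I (\sum_(k <- ks | p k) F k).
Proof.
by move=> idI IF; apply: big_ind => //; [exact: ideal0|move=> x y; exact: idealD].
Qed.

Lemma ideal_eq_of_diff I x y : is_ideal I -> I (x - y) -> I y -> I x.
Proof. by move=> idI Ixy Iy; rewrite -(subrK y x); apply: idealD. Qed.

Lemma ideal_genP (X : set T) : is_ideal (ideal_gen X).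
Proof.
split=> [A [[A0 AD AM] _] //|x y Xx Xy A idA|r x Xx A idA].
- by apply: idealD (idA.1) (Xx _ idA) (Xy _ idA).
- by apply: ideal_scalel (idA.1) (Xx _ idA).
Qed.

Lemma ideal_gen_le (X : set T) I : is_ideal I -> X `<=` I -> ideal_gen X `<=` I.
Proof. exact: smallest_sub. Qed.

Lemma mem_ideal_gen (X : set T) : X `<=` ideal_gen X.
Proof. exact: sub_gen_smallest. Qed.

Lemma multiples_ideal a : is_ideal [set x | exists r, x = r * a].
Proof.
split; first by exists 0; rewrite mul0r.
- by move=> _ _ [r ->] [t ->]; exists (r + t); rewrite mulrDl.
- by move=> r _ [t ->]; exists (r * t); rewrite mulrA.
Qed.

Lemma principalP a x : principal a x <-> exists r, x = r * a.
Proof.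
split=> [|[r ->]]; last first.
  by apply: (@ideal_scalel (principal a)); [exact: ideal_genP|exact: mem_ideal_gen].
have le : principal a `<=` [set x | exists r, x = r * a].
  by apply: ideal_gen_le; [exact: multiples_ideal|move=> _ ->; exists 1; rewrite mul1r].
exact: le.
Qed.

Lemma mem_ideal_mul I J x y : I x -> J y -> ideal_mul I J (x * y).
Proof. by move=> Ix Jy; apply: mem_ideal_gen; exists x => //; exists y. Qed.

Lemma ideal_mul_le I J N : is_ideal N ->
  (forall x y, I x -> J y -> N (x * y)) -> ideal_mul I J `<=` N.
Proof. by move=> idN IJN; apply: ideal_gen_le => // _ [x Ix [y Jy <-]]; exact: IJN. Qed.

Lemma ideal_mulP I J : is_ideal (ideal_mul I J).
Proof. exact: ideal_genP. Qed.

Lemma ideal_mul_subr I J : is_ideal J -> ideal_mul I J `<=` J.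
Proof. by move=> idJ; apply: ideal_mul_le => // x y _; exact: ideal_scalel. Qed.

Lemma ideal_gen_nil x : ideal_gen [set` ([::] : seq T)] x -> x = 0.
Proof.
have id0 : is_ideal [set 0 : T].
  by split=> // [_ _ -> ->|r _ ->]; rewrite ?addr0 ?mulr0.
have le : ideal_gen [set` ([::] : seq T)] `<=` [set 0] by exact: ideal_gen_le.
exact: le.
Qed.

Lemma ideal_gen_seq1 a : ideal_gen [set` [:: a]] = principal a.
Proof. by congr ideal_gen; apply/seteqP; split=> x /=; rewrite inE => /eqP. Qed.

Lemma lregP0 a : (forall x, a * x = 0 -> x = 0) -> GRing.lreg a.
Proof. by move=> a0 x y /eqP; rewrite -subr_eq0 -mulrBr => /eqP/a0/eqP; rewrite subr_eq0 => /eqP. Qed.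

Lemma lreg_eq0 a x : GRing.lreg a -> a * x = 0 -> x = 0.
Proof. by move=> rega; rewrite -[X in _ = X](mulr0 a) => /rega. Qed.

Lemma lreg_mulr a r : GRing.lreg (r * a) -> GRing.lreg a.
Proof.
move=> reg; apply: lregP0 => x ax; apply: (lreg_eq0 reg).
by rewrite -mulrA ax mulr0.
Qed.

Lemma setT_ideal : is_ideal [set: T]. Proof. by []. Qed.

Lemma adjoin_ideal N M h : is_ideal N -> is_ideal M ->
  is_ideal [set x | exists p r, [/\ N p, M r & x = p + r * h]].
Proof.
move=> idN idM; split.
- by exists 0, 0; rewrite mul0r addr0; split=> //; exact: ideal0.
- move=> _ _ [p [r [Np Mr ->]]] [q [t [Nq Mt ->]]]; exists (p + q), (r + t).
  by split; [exact: idealD|exact: idealD|ring].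
- move=> t _ [p [r [Np Mr ->]]]; exists (t * p), (t * r).
  by split; [exact: ideal_scalel|exact: ideal_scalel|ring].
Qed.

(** Maximality is with respect to all ideals missing [S]; this is Zorn's lemma
for the ideals between [I] and the complement of [S].  The empty set is added
to the family because the union of the empty chain is empty. *)
Lemma max_disjoint_ideal (S : set T) I : is_ideal I -> I `&` S = set0 ->
  exists P, [/\ is_ideal P, I `<=` P, P `&` S = set0
    & forall A, is_ideal A -> P `<=` A -> A `&` S = set0 -> A = P].
Proof.
move=> idI IS0.
pose C (X : set T) := X = set0 \/ [/\ is_ideal X, I `<=` X & X `&` S = set0].
have [F FC totF|P [[->|[idP IP PS]] maxP]] := @Zorn_bigcup T C.
- have [noneF|] := EM (forall X, F X -> X = set0).
    left; apply/seteqP; split=> // x [X FX]; by rewrite (noneF X FX).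
  move=> /existsNP[X0 /not_implyP[FX0 X0n]].
  have CX X : F X -> forall x, X x -> [/\ is_ideal X, I `<=` X & X `&` S = set0].
    by move=> FX x Xx; case: (FC _ FX) => // X0E; rewrite X0E in Xx.
  have [idX0 IX0 _] : [/\ is_ideal X0, I `<=` X0 & X0 `&` S = set0].
    by case: (FC _ FX0).
  right; split.
  + split; first by exists X0 => //; exact: ideal0.
    * move=> x y [X FX Xx] [Y FY Yy]; have [idX _ _] := CX _ FX _ Xx.
      have [idY _ _] := CX _ FY _ Yy.
      case: (totF _ _ FX FY) => [XY|YX].
        by exists Y => //; apply: idealD => //; exact: XY.
      by exists X => //; apply: idealD => //; exact: YX.
    * move=> r x [X FX Xx]; exists X => //; have [idX _ _] := CX _ FX _ Xx.
      exact: ideal_scalel.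
  + by move=> x Ix; exists X0 => //; exact: IX0.
  + apply/seteqP; split=> // x [[X FX Xx] Sx].
    by have [_ _ <-] := CX _ FX _ Xx.
- exfalso; apply: (maxP I); last by right; split.
  by split=> [? //|/(_ 0 (ideal0 idI))].
- exists P; split=> // A idA PA AS.
  apply: contrapT => neq; apply: (maxP A).
    by split=> // AP; apply: neq; apply/seteqP.
  by right; split=> //; apply: subset_trans PA.
Qed.

(** An ideal maximal among those missing a multiplicative set is prime: if
[x] and [y] are outside [P], then [P + (x)] and [P + (y)] both meet [S], and the
product of the two elements found is in [S] and in [P + (xy)]. *)
Lemma prime_of_mult_closed (S : set T) I : is_ideal I -> S 1 ->
  (forall x y, S x -> S y -> S (x * y)) -> I `&` S = set0 ->
  exists P, [/\ prime_ideal P, I `<=` P & P `&` S = set0].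
Proof.
move=> idI S1 SM IS0; have [P [idP IP PS maxP]] := max_disjoint_ideal idI IS0.
exists P; split=> //; split=> //.
  by move=> P1; suff: set0 (1 : T) by []; rewrite -PS.
pose Pplus x := [set w | exists p r, [/\ P p, setT r & w = p + r * x]].
have meetS x : ~ P x -> exists p r, P p /\ S (p + r * x).
  move=> nPx; apply: contrapT => none; apply: nPx.
  rewrite -(maxP (Pplus x) (adjoin_ideal x idP setT_ideal)).
  - by exists 0, 1; rewrite mul1r add0r; split=> //; exact: ideal0.
  - by move=> p Pp; exists p, 0; rewrite mul0r addr0.
  - apply/seteqP; split=> // w [[p [r [Pp _ wE]]] Sw]; apply: none.
    by exists p, r; rewrite -wE.
move=> x y Pxy; apply: contrapT => /not_orP[nPx nPy].
have [p [r [Pp Sp]]] := meetS _ nPx; have [q [t [Pq Sq]]] := meetS _ nPy.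
suff: set0 ((p + r * x) * (q + t * y)) by [].
rewrite -PS; split; last exact: SM.
have -> : (p + r * x) * (q + t * y)
    = p * (q + t * y) + (r * x * q + r * t * (x * y)) by ring.
by apply: idealD => //; [exact: ideal_scaler|apply: idealD => //; exact: ideal_scalel].
Qed.

End IdealCalculus.

(** * Local rings and Nakayama's lemma *)

Section LocalRing.
Context {T : comNzRingType} {m : set T}.
Hypothesis locT : local_ring m.
Implicit Types (I J N P : set T) (a b c r x y z : T) (s : seq T).

Lemma local_ideal : is_ideal m. Proof. by case: locT => _ []. Qed.
Lemma local_proper : ~ m 1. Proof. by case: locT => _ []. Qed.
Hint Resolve local_ideal : core.

Lemma proper_ideal_sub I : is_ideal I -> ~ I 1 -> I `<=` m.
Proof.
move=> idI nI1; have [|P [idP IP PS maxP]] := @max_disjoint_ideal _ [set 1] I idI.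
  by apply/seteqP; split=> // x [Ix /= xE]; rewrite xE in Ix.
case: locT => _ _ /(_ P) <- //; split=> // [P1|A idA nA1 PA].
  by suff: set0 (1 : T) by []; rewrite -PS.
by apply: maxP => //; apply/seteqP; split=> // x [Ax /= xE]; rewrite xE in Ax.
Qed.

Lemma unit_of_notin r : ~ m r -> exists r', r' * r = 1.
Proof.
move=> nmr; apply: contrapT => nounit; apply: nmr.
apply: (proper_ideal_sub (multiples_ideal r)); last by exists 1; rewrite mul1r.
by move=> [r' /esym E]; apply: nounit; exists r'.
Qed.

Lemma one_sub_notin x : m x -> ~ m (1 - x).
Proof. by move=> mx /(idealD local_ideal)/(_ mx); rewrite subrK; exact: local_proper. Qed.

Lemma local_prime : prime_ideal m.
Proof.
split=> //; first exact: local_proper.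
move=> x y mxy; have [|nmx] := EM (m x); [by left|right].
have [x' x'x] := unit_of_notin nmx.
by rewrite -[y]mul1r -x'x -mulrA; exact: ideal_scalel.
Qed.

Lemma local_radical I : I `<=` m -> radical I `<=` m.
Proof.
move=> Im x [k /Im]; elim: k => [|k IH]; first by rewrite expr0 => /local_proper.
have [_ _ primem] := local_prime.
by rewrite exprS => /primem[|//].
Qed.

Lemma primary_of_radical I : is_ideal I -> I `<=` m -> m `<=` radical I ->
  primary_to m I.
Proof.
move=> idI Im mI; split; last by apply/seteqP; split=> //; exact: local_radical.
split=> // [/Im/local_proper//|x y Ixy].
have [my|/unit_of_notin[y' y'y]] := EM (m y); [by right; exact: mI|left].
by rewrite -[x]mulr1 -y'y mulrCA; exact: ideal_scalel.
Qed.

(** By induction on the generators: working modulo [h], the remaining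
generators lie in [N + (h)], so that [h] is in [N + m h] and [1 - r], with [r] in
[m], is a unit. *)
Lemma nakayama_seq s N : is_ideal N ->
  (forall x, x \in s -> exists2 z, ideal_mul m (ideal_gen [set` s]) z & N (x - z)) ->
  forall x, x \in s -> N x.
Proof.
elim: s N => [//|h s IH] N idN gens.
pose G := ideal_gen [set` s]; have idG : is_ideal G by exact: ideal_genP.
pose Nh := [set x | exists p r, [/\ N p, setT r & x = p + r * h]].
have idNh : is_ideal Nh by exact: adjoin_ideal idN setT_ideal.
have idmG : is_ideal (ideal_mul m G) by exact: ideal_mulP.
have genG : ideal_gen [set` h :: s] `<=`
    [set x | exists p r, [/\ G p, setT r & x = p + r * h]].
  apply: ideal_gen_le; first exact: adjoin_ideal.
  move=> z /=; rewrite inE => /orP[/eqP->|zs].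
    by exists 0, 1; rewrite mul1r add0r; split=> //; exact: ideal0.
  by exists z, 0; rewrite mul0r addr0; split=> //; exact: mem_ideal_gen.
have mgen : ideal_mul m (ideal_gen [set` h :: s]) `<=`
    [set x | exists z r, [/\ ideal_mul m G z, m r & x = z + r * h]].
  apply: ideal_mul_le; first exact: adjoin_ideal.
  move=> x y mx /genG[w [t [sw _ ->]]]; exists (x * w), (x * t).
  by split; [exact: mem_ideal_mul|exact: ideal_scaler|ring].
have sNh x : x \in s -> Nh x.
  apply: IH => // {}x xs.
  have [|z /mgen[w [r [mw mr ->]]] Nxz] := gens x; first by rewrite inE xs orbT.
  by exists w => //; exists (x - (w + r * h)), r; split=> //; ring.
have genNh : G `<=` Nh by exact: ideal_gen_le.
have Nh_h : N h.
  have [|z /mgen[w [r [mw mr ->]]] Nhz] := gens h; first by rewrite inE eqxx.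
  have mNh : ideal_mul m G `<=`
      [set x | exists q t, [/\ N q, m t & x = q + t * h]].
    apply: ideal_mul_le; first exact: adjoin_ideal.
    move=> x y mx /genNh[p [t [Np _ ->]]]; exists (x * p), (x * t).
    by split; [exact: ideal_scalel|exact: ideal_scaler|ring].
  have [q [t [Nq mt wE]]] := mNh _ mw.
  have [|v vE] := @unit_of_notin (1 - (t + r)).
    by apply: one_sub_notin; exact: idealD.
  rewrite -[h]mul1r -vE -mulrA; apply: ideal_scalel => //.
  have -> : (1 - (t + r)) * h = (h - (w + r * h)) + q by rewrite wE; ring.
  exact: idealD.
move=> x; rewrite inE => /orP[/eqP->//|/sNh[p [r [Np _ ->]]]].
by apply: idealD => //; exact: ideal_scalel.
Qed.

Lemma nakayama I N : is_ideal I -> is_ideal N ->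
  (forall x, I x -> exists2 z, ideal_mul m I z & N (x - z)) -> I `<=` N.
Proof.
case: locT => noeT _ _ idI idN IN; have [s sE] := noeT I idI.
rewrite sE; apply: ideal_gen_le => //; apply: nakayama_seq => // x xs.
by rewrite -sE; apply: IN; rewrite sE; exact: mem_ideal_gen.
Qed.

End LocalRing.

(** * Bases of the conormal module *)

Section Conormal.
Context {T : comNzRingType}.
Implicit Types (I J N m P : set T) (a b c r x y z : T).

Definition conormal_basis I n (x : 'I_n -> T) : Prop :=
  [/\ forall i, I (x i),
      forall y, I y -> exists c : 'I_n -> T, ideal_pow I 2 (y - \sum_(i < n) c i * x i)
    & forall c : 'I_n -> T,
        ideal_pow I 2 (\sum_(i < n) c i * x i) -> forall i, I (c i)].

(** That is, [I^2] is contained in [aI].  For [a] in [I] this is the equality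
[I^2 = aI] of the definition of an Ulrich ideal, in a form that can be divided
by [a] element by element. *)
Definition sqr_sub a I : Prop :=
  forall x y, I x -> I y -> exists2 z, I z & x * y = a * z.

Lemma sqr_ideal I : is_ideal (ideal_pow I 2).
Proof. exact: ideal_mulP. Qed.

Lemma ideal_pow1 I : is_ideal I -> ideal_pow I 1 = I.
Proof.
move=> idI; apply/seteqP; split=> [|x Ix].
  apply: ideal_mul_le => // z y Iz _. exact: ideal_scaler.
by rewrite -[x]mulr1; exact: mem_ideal_mul.
Qed.

Lemma ideal_pow2 I : is_ideal I -> ideal_pow I 2 = ideal_mul I I.
Proof. by move=> idI; rewrite -[LHS]/(ideal_mul I (ideal_pow I 1)) ideal_pow1. Qed.

Lemma mem_sqr I x y : is_ideal I -> I x -> I y -> ideal_pow I 2 (x * y).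
Proof. by move=> idI Ix Iy; rewrite ideal_pow2 //; exact: mem_ideal_mul. Qed.

Lemma sqr_le I N : is_ideal I -> is_ideal N ->
  (forall x y, I x -> I y -> N (x * y)) -> ideal_pow I 2 `<=` N.
Proof. by move=> idI idN IN; rewrite ideal_pow2 //; exact: ideal_mul_le. Qed.

Lemma scaled_ideal a I : is_ideal I -> is_ideal [set x | exists2 z, I z & x = a * z].
Proof.
move=> idI; split; first by exists 0; [exact: ideal0|rewrite mulr0].
- by move=> _ _ [x Ix ->] [y Iy ->]; exists (x + y); [exact: idealD|rewrite mulrDr].
- by move=> r _ [x Ix ->]; exists (r * x); [exact: ideal_scalel|rewrite mulrCA].
Qed.

Lemma sqr_memP a I x : is_ideal I -> I a -> sqr_sub a I ->
  ideal_pow I 2 x <-> exists2 z, I z & x = a * z.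
Proof.
move=> idI Ia Isq; split=> [|[z Iz ->]]; last exact: mem_sqr.
have le : ideal_pow I 2 `<=` [set x | exists2 z, I z & x = a * z].
  by apply: sqr_le => //; exact: scaled_ideal.
exact: le.
Qed.

Lemma sqr_sub_lreg a a' I : I a -> GRing.lreg a -> sqr_sub a' I -> GRing.lreg a'.
Proof.
move=> Ia rega Isq; apply: lregP0 => x ax0.
have [z _ zE] := Isq _ _ Ia Ia.
apply: (lreg_eq0 rega); apply: (lreg_eq0 rega).
by rewrite mulrA zE mulrAC ax0 mul0r.
Qed.

(** Steinitz exchange over the ring [T/I]. *)
Lemma conormal_exchange I n (x : 'I_n -> T) (c : 'I_n -> T) u r (j : 'I_n) :
  is_ideal I -> conormal_basis I x -> I u ->
  ideal_pow I 2 (u - \sum_(i < n) c i * x i) -> r * c j = 1 ->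
  conormal_basis I (fun i => if i == j then u else x i).
Proof.
move=> idI [Ix gen indep] Iu uE rc; have idI2 := sqr_ideal I.
have sumE (d : 'I_n -> T) :
    \sum_(i < n) d i * (if i == j then u else x i) =
    d j * u + \sum_(i < n | i != j) d i * x i.
  rewrite (bigD1 j) //= eqxx; congr (_ + _).
  by apply: eq_bigr => i /negPf->.
split=> [i|y Iy|d].
- by case: ifP.
- have [d dE] := gen _ Iy.
  exists (fun i => if i == j then d j * r else d i - d j * r * c i).
  rewrite sumE eqxx.
  have -> : y - (d j * r * u + \sum_(i < n | i != j)
        (if i == j then d j * r else d i - d j * r * c i) * x i)
     = (y - \sum_(i < n) d i * x i) - d j * r * (u - \sum_(i < n) c i * x i).
    rewrite (eq_bigr (fun i => d i * x i - d j * r * (c i * x i))).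
      rewrite sumrB -mulr_sumr.
      rewrite [in RHS](bigD1 j) //= [\sum_(i < n) c i * _](bigD1 j) //=.
      have -> : d j * x j = d j * x j * (r * c j) by rewrite rc mulr1.
      ring.
    by move=> i /negPf->; ring.
  by apply: (idealB idI2) => //; exact: (ideal_scalel _ idI2).
- rewrite sumE => dE.
  have key : ideal_pow I 2
      (\sum_(i < n) (d j * c i + (if i == j then 0 else d i)) * x i).
    have -> : \sum_(i < n) (d j * c i + (if i == j then 0 else d i)) * x i
       = (d j * u + \sum_(i < n | i != j) d i * x i)
         - d j * (u - \sum_(i < n) c i * x i).
      rewrite (eq_bigr (fun i => d j * (c i * x i) + (if i == j then 0 else d i * x i))).
        rewrite big_split /= -mulr_sumr [X in _ + X](bigD1 j) //= eqxx add0r.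
        rewrite [X in _ + X = _](eq_bigr (fun i => d i * x i)); first by ring.
        by move=> i /negPf->.
      by move=> i _; case: (i == j); ring.
    by apply: (idealB idI2) => //; exact: (ideal_scalel _ idI2).
  have Idj : I (d j).
    move: (indep _ key j); rewrite eqxx addr0 => Idc.
    by rewrite -[d j]mulr1 -rc mulrCA; exact: ideal_scalel.
  move=> i; have [->//|neq] := eqVneq i j.
  move: (indep _ key i); rewrite (negPf neq) => Idi.
  by rewrite -[d i](addKr (d j * c i)) addrC; apply: idealB => //; exact: ideal_scaler.
Qed.

(** In a free [T/I]-module the elements killed by [b] are the
[(I : b)]-combinations of a basis. *)
Lemma conormal_colon I b v :
  is_ideal I -> conormal_free I -> I v -> ideal_pow I 2 (b * v) ->
  exists (n : nat) (c x : 'I_n -> T), [/\ forall i, I (x i),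
    forall i, I (b * c i) & ideal_pow I 2 (v - \sum_(i < n) c i * x i)].
Proof.
move=> idI [n [x [Ix gen indep]]] Iv bv; have idI2 := sqr_ideal I; have [c cE] := gen _ Iv.
exists n, c, x; split=> //; apply: indep.
under eq_bigr do rewrite -mulrA.
rewrite -mulr_sumr.
have -> : b * (\sum_(i < n) c i * x i) = b * v - b * (v - \sum_(i < n) c i * x i).
  by ring.
by apply: (idealB idI2) => //; exact: (ideal_scalel _ idI2).
Qed.

End Conormal.

Section ConormalLocal.
Context {T : comNzRingType} {m : set T}.
Hypothesis locT : local_ring m.
Implicit Types (I J N P : set T) (a b c r x y z : T).

Lemma conormal_coef I n (x : 'I_n -> T) (c : 'I_n -> T) u :
  is_ideal I -> I `<=` m -> conormal_basis I x ->
  ideal_pow I 2 (u - \sum_(i < n) c i * x i) -> ~ ideal_mul m I u ->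
  exists j, ~ m (c j).
Proof.
move=> idI Im [Ix _ _] uE nu; apply: contrapT => /forallNP allm; apply: nu.
have idmI := ideal_mulP m I.
rewrite -[u](subrK (\sum_(i < n) c i * x i)); apply: (idealD idmI).
  move: uE; apply: (sqr_le idI idmI) => y z Iy Iz.
  by apply: mem_ideal_mul => //; exact: Im.
by apply: (ideal_sum _ idmI) => i _; apply: mem_ideal_mul => //; apply: contrapT; exact: allm.
Qed.

Lemma conormal_basis_with I u :
  is_ideal I -> I `<=` m -> conormal_free I -> I u -> ~ ideal_mul m I u ->
  exists (n : nat) (x : 'I_n -> T) (j : 'I_n), x j = u /\ conormal_basis I x.
Proof.
move=> idI Im [n [x bx]] Iu nu; have [_ gen _] := bx; have [c cE] := gen _ Iu.
have [j] := conormal_coef idI Im bx cE nu.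
case/(unit_of_notin locT) => r rc.
exists n, (fun i => if i == j then u else x i), j; rewrite eqxx; split=> //.
exact: conormal_exchange idI bx Iu cE rc.
Qed.

(** Elements of a free module that are independent modulo [m] are part of a
basis, here for two elements: [u] is exchanged into a basis, and a coefficient
of [v] on another basis element is then a unit. *)
Lemma conormal_independent2 I u v y z :
  is_ideal I -> I `<=` m -> conormal_free I -> I u -> I v ->
  ~ ideal_mul m I u -> (forall r, ~ ideal_mul m I (v - r * u)) ->
  ideal_pow I 2 (y * u + z * v) -> I y /\ I z.
Proof.
move=> idI Im frI Iu Iv nu nv yz; have idI2 := sqr_ideal I.
have [n [x [j [xj bx]]]] := conormal_basis_with idI Im frI Iu nu.
have [_ gen indep] := bx; have [d dE] := gen _ Iv.
have [|k] := conormal_coef (u := v - d j * u)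
    (c := fun i => if i == j then 0 else d i) idI Im bx _ (nv _).
  have -> : v - d j * u - \sum_(i < n) (if i == j then 0 else d i) * x i
      = v - \sum_(i < n) d i * x i.
    rewrite (bigD1 j) //= [\sum_(i < n) d i * _](bigD1 j) //= eqxx xj.
    rewrite [in LHS](eq_bigr (fun i => d i * x i)); first by ring.
    by move=> i /negPf->.
  by [].
case: eqVneq => [_ /(_ (ideal0 (local_ideal locT)))//|neq].
case/(unit_of_notin locT) => r rd.
have /indep yzI : ideal_pow I 2
    (\sum_(i < n) ((if i == j then y else 0) + z * d i) * x i).
  have -> : \sum_(i < n) ((if i == j then y else 0) + z * d i) * x i
      = (y * u + z * v) - z * (v - \sum_(i < n) d i * x i).
    rewrite (eq_bigr (fun i => (if i == j then y * x i else 0) + z * (d i * x i))).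
      by rewrite big_split /= -mulr_sumr -big_mkcond big_pred1_eq xj; ring.
    by move=> i _; case: (i == j); ring.
  by apply: (idealB idI2) => //; exact: (ideal_scalel _ idI2).
have Iz : I z.
  move: (yzI k); rewrite (negPf neq) add0r => Izd.
  by rewrite -[z]mulr1 -rd mulrCA; exact: ideal_scalel.
split=> //; move: (yzI j); rewrite eqxx => Iyz.
by rewrite -[y](addrK (z * d j)); apply: idealB => //; exact: ideal_scaler.
Qed.

End ConormalLocal.

(** * Ulrich ideals with a chosen reduction *)

(** The definition of an Ulrich ideal in elementwise form, with the reduction as
a parameter: the arguments divide by the reduction and change it. *)
Record ulrich_with (T : comNzRingType) (m I : set T) (a : T) : Prop := UlrichWith {
  uw_ideal : is_ideal I;
  uw_sub : I `<=` m;
  uw_rad : m `<=` radical I;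
  uw_mem : I a;
  uw_reg : GRing.lreg a;
  uw_sqr : sqr_sub a I;
  uw_nonprincipal : ~ (I `<=` [set x | exists r, x = r * a]);
  uw_free : conormal_free I }.

Section UlrichLocal.
Context {T : comNzRingType} {m : set T}.
Hypothesis locT : local_ring m.
Implicit Types (I J N P : set T) (a b c r x y z : T).

(** Read in [A = I/a]: [N A] is an [A]-module. *)
Lemma sqr_sub_mul N I a v y : is_ideal I -> sqr_sub a I ->
  ideal_mul N I v -> I y -> exists2 z, ideal_mul N I z & v * y = a * z.
Proof.
move=> idI Isq; have idNI := ideal_mulP N I.
move=> + Iy; have le : ideal_mul N I `<=`
    [set v | exists2 z, ideal_mul N I z & v * y = a * z].
  apply: ideal_mul_le.
    split; first by exists 0; [exact: (ideal0 idNI)|rewrite mulr0 mul0r].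
    - move=> p q [z Nz pE] [w Nw qE]; exists (z + w); first exact: (idealD idNI).
      by rewrite mulrDl pE qE mulrDr.
    - move=> r p [z Nz pE]; exists (r * z); first exact: (ideal_scalel _ idNI).
      by rewrite -mulrA pE mulrCA.
  move=> p q Np Iq; have [z Iz qyE] := Isq _ _ Iq Iy.
  by exists (p * z); [exact: mem_ideal_mul|rewrite -mulrA qyE mulrCA].
exact: le.
Qed.

(** Otherwise [A = mA], which Nakayama forbids; so [a] can be completed to a
basis of [I/I^2], i.e. [A/I] has a basis containing [1]. *)
Lemma ulrich_notin_mI I a : ulrich_with m I a -> ~ ideal_mul m I a.
Proof.
move=> uI aM; have idI := uw_ideal uI.
have id0 : is_ideal [set x | exists r : T, x = r * 0] by exact: multiples_ideal.
have I0 : I `<=` [set x | exists r : T, x = r * 0].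
  apply: (nakayama locT) => // x Ix.
  have [z Mz /(uw_reg uI) xz] := sqr_sub_mul idI (uw_sqr uI) aM Ix.
  by exists x; rewrite xz // subrr; exists 0; rewrite mulr0.
have [r] := I0 _ (uw_mem uI); rewrite mulr0 => a0.
have /(uw_reg uI)/eqP : a * 1 = a * 0 by rewrite a0 !mul0r.
by rewrite oner_eq0.
Qed.

Lemma ulrich_change I a a' : ulrich_with m I a -> I a' -> sqr_sub a' I ->
  ulrich_with m I a'.
Proof.
move=> uI Ia' Isq; have rega' := sqr_sub_lreg (uw_mem uI) (uw_reg uI) Isq.
case: uI => idI Im mI Ia rega Isqa nprinc frI; split=> // Ia'E.
have [z Iz zE] := Isqa _ _ Ia' Ia'; have [r rE] := Ia'E _ Iz.
apply: nprinc => x /Ia'E[t ->]; exists (t * r).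
have -> : a' = r * a; last by rewrite mulrA.
by apply: rega'; rewrite zE rE; ring.
Qed.

(** The rank of [I/I^2] is at least two, since [I] is not generated by [a]. *)
Lemma ulrich_exists_outside I a : ulrich_with m I a ->
  exists2 v, I v & forall r, ~ ideal_mul m I (v - r * a).
Proof.
move=> uI; apply: contrapT => none; apply: (uw_nonprincipal uI).
apply: (nakayama locT (uw_ideal uI) (multiples_ideal a)) => x Ix.
apply: contrapT => nx; apply: none; exists x => // r Mxr.
by apply: nx; exists (x - r * a) => //; exists r; ring.
Qed.

(** This is [R : A = I].  A basis of [A/I] contains [1] and a second element
[v/a]; if [y v/a] is in [R], then [y v/a] and [y] are the coefficients of a
relation between [1] and [v/a]. *)
Lemma ulrich_colon I a y : ulrich_with m I a ->
  (forall v, I v -> exists r, y * v = r * a) -> I y.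
Proof.
move=> uI yI; have [v Iv nv] := ulrich_exists_outside uI.
have [r yv] := yI _ Iv.
have [] // := conormal_independent2 (y := - r) (z := y) locT (uw_ideal uI) (uw_sub uI)
  (uw_free uI) (uw_mem uI) Iv (ulrich_notin_mI uI) nv.
rewrite yv mulNr addNr; exact: (ideal0 (sqr_ideal I)).
Qed.

(** Reductions are open in the [m]-adic topology of [I]: with [a'/a] in
[1 + mA] a unit of [A]. *)
Lemma ulrich_perturb I a a' : ulrich_with m I a -> I a' -> ideal_mul m I (a' - a) ->
  sqr_sub a' I.
Proof.
move=> uI Ia' Ma'a; have idI := uw_ideal uI.
have le : I `<=` [set x | I x /\ exists2 z, I z & a * x = a' * z].
  apply: (nakayama locT idI).
    split; first by split; [exact: ideal0|exists 0; [exact: ideal0|rewrite !mulr0]].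
    - move=> x y [Ix [z Iz xE]] [Iy [w Iw yE]]; split; first exact: idealD.
      by exists (z + w); [exact: idealD|rewrite !mulrDr xE yE].
    - move=> r x [Ix [z Iz xE]]; split; first exact: ideal_scalel.
      by exists (r * z); [exact: ideal_scalel|rewrite mulrCA xE mulrCA].
  move=> x Ix; have [z Mz zE] := sqr_sub_mul idI (uw_sqr uI) Ma'a Ix.
  exists (- z); first exact: (idealN (ideal_mulP _ _)).
  have Iz : I z by apply: (ideal_mul_subr (I := m) idI).
  rewrite opprK; split; first exact: idealD.
  by exists x => //; rewrite mulrDr -zE; ring.
move=> x y Ix Iy; have [z /le[_ [w Iw zE]] ->] := uw_sqr uI Ix Iy.
by exists w.
Qed.

(** With [A = I/a], the set [JI/c] is an [A]-module contained in [J^2/c], which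
lies in [J], hence in [R]; so it lies in [R : A = I]. *)
Lemma nested_mul I J a c : ulrich_with m I a -> is_ideal J -> I `<=` J ->
  GRing.lreg c -> sqr_sub c J -> forall x y, J x -> I y -> exists2 z, I z & x * y = c * z.
Proof.
move=> uI idJ IJ regc Jsq x y Jx Iy; have [w Jw wE] := Jsq _ _ Jx (IJ _ Iy).
exists w => //; apply: (ulrich_colon uI) => v Iv.
have [z Iz zE] := uw_sqr uI Iy Iv.
have [w' Jw' w'E] := Jsq _ _ Jx (IJ _ Iz).
exists w'; apply: regc.
by rewrite mulrA -wE -mulrA zE mulrCA w'E; ring.
Qed.

(** By [nested_mul], [J/c] lies in [A].  For [x] in [J] write [x/c] on a basis of
[A/I] that contains [1]: since [x] itself is in [R], comparing the coefficients
of [1] in [x = c (x/c)] puts [x - c d] in [I], where [d] is the coefficient of [1]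
in [x/c]. *)
Lemma nested_span I J a c : ulrich_with m I a -> is_ideal J -> I `<=` J ->
  GRing.lreg c -> sqr_sub c J -> forall x, J x -> exists r i, I i /\ x = r * c + i.
Proof.
move=> uI idJ IJ regc Jsq x Jx; have idI2 := sqr_ideal I.
have [v Iv vE] := nested_mul uI idJ IJ regc Jsq Jx (uw_mem uI).
have [n [w [j [wj bw]]]] := conormal_basis_with locT (uw_ideal uI) (uw_sub uI)
  (uw_free uI) (uw_mem uI) (ulrich_notin_mI uI).
have [_ gen indep] := bw; have [d dE] := gen _ Iv.
have /indep/(_ j) : ideal_pow I 2
    (\sum_(i < n) ((if i == j then x else 0) - c * d i) * w i).
  have -> : \sum_(i < n) ((if i == j then x else 0) - c * d i) * w i
      = c * (v - \sum_(i < n) d i * w i).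
    rewrite (eq_bigr (fun i => (if i == j then x * w i else 0) - c * (d i * w i))).
      by rewrite sumrB -mulr_sumr -big_mkcond big_pred1_eq wj vE; ring.
    by move=> i _; case: (i == j); ring.
  exact: (ideal_scalel _ idI2).
by rewrite eqxx => Ixj; exists (d j), (x - c * d j); split=> //; ring.
Qed.

(** The candidates for a reduction of [I] divisible by [c] are the elements of
the intersection [V] of [I] and [cR].  They do not all lie in [mI], because [a^2]
is in [VI].  Any two of them, [c r1] and [c r2], satisfy a relation with coefficients
[r2] and [- r1]; freeness of [I/I^2] forbids it for elements independent modulo
[mI], since [r1] in [I] would put [c r1] in [mI]. *)
Lemma nested_reduction I J a c : ulrich_with m I a -> is_ideal J -> I `<=` J ->
  J `<=` m -> J c -> GRing.lreg c -> sqr_sub c J ->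
  exists r, I (c * r) /\ sqr_sub (c * r) I.
Proof.
move=> uI idJ IJ Jm Jc regc Jsq; have [idI Ia] := (uw_ideal uI, uw_mem uI).
have idM := ideal_mulP m I; have idI2 := sqr_ideal I.
pose V := [set v | I v /\ exists r, v = c * r].
have idV : is_ideal V.
  split; first by split; [exact: ideal0|exists 0; rewrite mulr0].
  - move=> x y [Ix [r xE]] [Iy [t yE]]; split; first exact: idealD.
    by exists (r + t); rewrite mulrDr xE yE.
  - move=> t x [Ix [r xE]]; split; first exact: ideal_scalel.
    by exists (t * r); rewrite xE mulrCA.
(* With [a a = c v] and [v = sum d_i x_i + a w], the relation [c v] in [I^2] puts
   every [c d_i] in [I], hence in [V]; and [c a] is in [V] as well. *)
have a2V : ideal_mul V I (a * a).
  have [v Iv vE] := nested_mul uI idJ IJ regc Jsq (IJ _ Ia) Ia.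
  have [|n [d [x [Ix Id dE]]]] := @conormal_colon _ I c v idI (uw_free uI) Iv.
    by rewrite -vE; exact: mem_sqr.
  have [w Iw wE] := (sqr_memP _ idI Ia (uw_sqr uI)).1 dE.
  have -> : a * a = \sum_(i < n) (c * d i) * x i + (c * a) * w.
    rewrite vE -[v](subrK (\sum_(i < n) d i * x i)) wE.
    under [in RHS]eq_bigr do rewrite -mulrA.
    by rewrite -mulr_sumr; ring.
  have idVI := ideal_mulP V I.
  apply: (idealD idVI).
    by apply: (ideal_sum _ idVI) => i _; apply: mem_ideal_mul => //; split=> //; exists (d i).
  by apply: mem_ideal_mul => //; split; [exact: ideal_scalel|exists a].
have aMle N : is_ideal N -> (forall v y, V v -> I y -> N (v * y)) -> N (a * a).
  by move=> idN VN; apply: (ideal_mul_le idN VN).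
(* If [V] were inside [mI], then [a^2] would be in [a mI], and [a] in [mI]. *)
have [v1 [[Iv1 [r1 v1E]] nv1]] : exists v, V v /\ ~ ideal_mul m I v.
  apply: contrapT => /forallNP VM; apply: (ulrich_notin_mI uI).
  have [|v y Vv Iy|z Mz /(uw_reg uI)-> //] := aMle
      [set x | exists2 z, ideal_mul m I z & x = a * z].
    exact: scaled_ideal.
  apply: (sqr_sub_mul idI (uw_sqr uI)) => //.
  by apply: contrapT => nMv; apply: (VM v).
have [Vspan|] := EM (forall v, V v -> exists r, ideal_mul m I (v - r * v1)); last first.
  move=> /existsNP[v2 /not_implyP[[Iv2 [r2 v2E]] /forallNP nv2]].
  have [|Ir2 Ir1] := conormal_independent2 (y := r2) (z := - r1) locT idI (uw_sub uI)
    (uw_free uI) Iv1 Iv2 nv1 nv2.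
    have -> : r2 * v1 + - r1 * v2 = 0 by rewrite v1E v2E; ring.
    exact: (ideal0 idI2).
  case: nv1; rewrite v1E; apply: mem_ideal_mul; first exact: Jm.
  by rewrite -[r1]opprK; exact: idealN.
exists r1; rewrite -v1E; split=> //.
(* [a^2] is in [VI], and [VI] lies in [v1 I + (mI) I = v1 I + a mI]. *)
have a2E : exists y z, [/\ I y, ideal_mul m I z & a * a = v1 * y + a * z].
  have := aMle [set x | exists y z, [/\ I y, ideal_mul m I z & x = v1 * y + a * z]].
  apply.
    split; first by exists 0, 0; split; [exact: ideal0|exact: (ideal0 idM)|rewrite !mulr0 addr0].
    - move=> _ _ [y [z [Iy Mz ->]]] [y' [z' [Iy' Mz' ->]]]; exists (y + y'), (z + z').
      by split; [exact: idealD|exact: (idealD idM)|ring].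
    - move=> t _ [y [z [Iy Mz ->]]]; exists (t * y), (t * z).
      by split; [exact: ideal_scalel|exact: (ideal_scalel _ idM)|ring].
  move=> v y Vv Iy; have [r Mr] := Vspan _ Vv.
  have [z Mz zE] := sqr_sub_mul idI (uw_sqr uI) Mr Iy.
  exists (r * y), z; split=> //; first exact: ideal_scalel.
  by rewrite -zE; ring.
have [y [z [Iy Mz aE]]] := a2E.
have le : I `<=` [set x | I x /\ exists2 w, I w & a * x = v1 * w].
  apply: (nakayama locT idI).
    split; first by split; [exact: ideal0|exists 0; [exact: ideal0|rewrite !mulr0]].
    - move=> p q [Ip [w Iw pE]] [Iq [w' Iw' qE]]; split; first exact: idealD.
      by exists (w + w'); [exact: idealD|rewrite !mulrDr pE qE].
    - move=> r p [Ip [w Iw pE]]; split; first exact: ideal_scalel.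
      by exists (r * w); [exact: ideal_scalel|rewrite mulrCA pE mulrCA].
  move=> x Ix; have [w Iw wE] := uw_sqr uI Iy Ix.
  have [z' Mz' z'E] := sqr_sub_mul idI (uw_sqr uI) Mz Ix.
  exists z' => //; split; first by apply: idealB => //; exact: (ideal_mul_subr (I := m)).
  exists w => //; apply: (uw_reg uI).
  have -> : a * (a * (x - z')) = a * a * x - a * (a * z') by ring.
  rewrite aE -z'E.
  have -> : (v1 * y + a * z) * x - a * (z * x) = v1 * (y * x) by ring.
  by rewrite wE; ring.
move=> p q Ip Iq; have [w /le[_ [w' Iw' wE]] ->] := uw_sqr uI Ip Iq.
by exists w'.
Qed.

(** In [J/d] the element [i/d] has its square in [r (J/d)], so [c/d = s + i/d] is
a unit: [(s + i/d)(s - i/d)] is [s^2] up to an element of [m (J/d)]. *)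
Lemma nested_change I J d c r s s' i : is_ideal I -> is_ideal J -> I `<=` J ->
  J d -> GRing.lreg d -> sqr_sub d J ->
  (forall x y, J x -> I y -> exists2 z, I z & x * y = d * z) ->
  m r -> sqr_sub (d * r) I ->
  s' * s = 1 -> I i -> c = s * d + i -> sqr_sub c J.
Proof.
move=> idI idJ IJ Jd regd Jsq JI mr Isq ss Ii cE.
have Jc : J c by rewrite cE; apply: idealD => //; [exact: ideal_scalel|exact: IJ].
have le : J `<=` [set x | J x /\ exists2 z, J z & d * x = c * z].
  apply: (nakayama locT idJ).
    split; first by split; [exact: ideal0|exists 0; [exact: ideal0|rewrite !mulr0]].
    - move=> p q [Ip [w Iw pE]] [Iq [w' Iw' qE]]; split; first exact: idealD.
      by exists (w + w'); [exact: idealD|rewrite !mulrDr pE qE].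
    - move=> t p [Ip [w Iw pE]]; split; first exact: ideal_scalel.
      by exists (t * w); [exact: ideal_scalel|rewrite mulrCA pE mulrCA].
  move=> x Jx.
  (* [s d = c - i], so that [(s d)^2 x = c (c - 2 i) x + i^2 x]. *)
  have [w Jw wE] : exists2 w, J w & (c - i - i) * x = d * w.
    by apply: Jsq => //; do 2![apply: idealB => //; last exact: IJ].
  have [v Iv vE] := Isq _ _ Ii Ii.
  have [w' Iw' w'E] := JI _ _ Jx Iv.
  exists (r * (s' * s' * w')).
    by apply: mem_ideal_mul => //; apply: ideal_scalel => //; exact: IJ.
  split.
    by apply: idealB => //; do 2!apply: ideal_scalel => //; exact: IJ.
  exists (s' * s' * w); first exact: ideal_scalel.
  apply: regd.
  have E : s * d = c - i by rewrite cE addrK.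
  have -> : d * (d * (x - r * (s' * s' * w')))
     = (s' * s) * (s' * s) * d * d * x - (s' * s') * ((d * r) * (d * w')).
    by rewrite ss; ring.
  rewrite -w'E.
  have -> : d * r * (x * v) = (i * i) * x by rewrite vE; ring.
  have -> : s' * s * (s' * s) * d * d * x = s' * s' * (s * d) * (s * d) * x by ring.
  rewrite E.
  have -> : s' * s' * (c - i) * (c - i) * x - s' * s' * (i * i * x)
     = s' * s' * c * ((c - i - i) * x) by ring.
  by rewrite wE; ring.
move=> p q Ip Iq; have [w /le[_ [w' Iw' wE]] ->] := Jsq _ _ Ip Iq.
by exists w'.
Qed.

(** With [D = N/e] and [A = I/(eu)] one has [D = R + uA], so a basis [1, f_k] of
[A] gives generators [1, u f_k] of [D].  Multiplied by [u], a relation between them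
over [T/N] becomes a relation in [I/I^2] whose coefficients on the [f_k] are
multiples of [u]; and [I : u] lies in [N] by freeness of [A/I]. *)
Lemma nested_conormal_free I N a e u : ulrich_with m I a -> is_ideal N -> I `<=` N ->
  N e -> sqr_sub e N -> (forall x, N x -> exists r i, I i /\ x = r * e + i) ->
  I (e * u) -> sqr_sub (e * u) I -> conormal_free N.
Proof.
move=> uI idN IN Ne Nsq Nspan Ieu Isq; have idI := uw_ideal uI.
have idI2 := sqr_ideal I; have idN2 := sqr_ideal N.
have uIe := ulrich_change uI Ieu Isq.
have [n [x [j [xj bx]]]] := conormal_basis_with locT idI (uw_sub uI)
  (uw_free uI) Ieu (ulrich_notin_mI uIe).
have [Ix gen indep] := bx.
have sqrI y : ideal_pow I 2 y <-> exists2 z, I z & y = e * u * z.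
  exact: sqr_memP.
have sumE (d : 'I_n -> T) :
    \sum_(i < n) d i * (if i == j then e else x i) =
    d j * e + \sum_(i < n | i != j) d i * x i.
  rewrite (bigD1 j) //= eqxx; congr (_ + _).
  by apply: eq_bigr => i /negPf->.
have colon c : I (u * c) -> N c.
  move=> Iuc; have [d dE] := gen _ Iuc.
  have /indep/(_ j) : ideal_pow I 2
      (\sum_(i < n) ((if i == j then c else 0) - e * d i) * x i).
    have -> : \sum_(i < n) ((if i == j then c else 0) - e * d i) * x i
        = e * (u * c - \sum_(i < n) d i * x i).
      rewrite (eq_bigr (fun i => (if i == j then c * x i else 0) - e * (d i * x i))).
        by rewrite sumrB -mulr_sumr -big_mkcond big_pred1_eq xj; ring.
      by move=> i _; case: (i == j); ring.
    exact: (ideal_scalel _ idI2).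
  rewrite eqxx => /IN Nc; rewrite -[c](subrK (e * d j)); apply: idealD => //.
  exact: ideal_scaler.
exists n, (fun i => if i == j then e else x i); split=> [i|y Ny|d].
- by case: ifP => // _; exact: IN.
- have [r [i [Ii ->]]] := Nspan _ Ny; have [d dE] := gen _ Ii.
  exists (fun k => if k == j then r + d j * u else d k); rewrite sumE eqxx.
  have -> : r * e + i - ((r + d j * u) * e
        + \sum_(k < n | k != j) (if k == j then r + d j * u else d k) * x k)
      = i - \sum_(k < n) d k * x k.
    rewrite [in RHS](bigD1 j) //= xj.
    rewrite [in LHS](eq_bigr (fun k => d k * x k)); first by ring.
    by move=> k /negPf->.
  case/sqrI: dE => z Iz ->; rewrite -mulrA; apply: mem_sqr => //.
  by apply: ideal_scalel => //; exact: IN.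
- rewrite sumE => /(sqr_memP _ idN Ne Nsq)[w Nw wE].
  have [t [i [Ii wtE]]] := Nspan _ Nw.
  have /indep dI : ideal_pow I 2
      (\sum_(k < n) (if k == j then d j - e * t else u * d k) * x k).
    apply/sqrI; exists i => //.
    rewrite (bigD1 j) //= eqxx xj.
    rewrite (eq_bigr (fun k => u * (d k * x k))); last first.
      by move=> k /negPf->; rewrite mulrA.
    rewrite -mulr_sumr.
    have -> : \sum_(k < n | k != j) d k * x k = e * w - d j * e by rewrite -wE; ring.
    by rewrite wtE; ring.
  move=> k; move: (dI k); case: eqVneq => [-> /IN Ndj|_]; last exact: colon.
  rewrite -[d j](subrK (e * t)); apply: idealD => //; exact: ideal_scaler.
Qed.

End UlrichLocal.

(** * Local rings of dimension one *)

Section DimensionOne.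
Context {T : comNzRingType} {m : set T}.
Hypothesis locT : local_ring m.
Implicit Types (I J N P q : set T) (a b c r x y z : T) (s : seq T).

Lemma prime_pow P x k : prime_ideal P -> P (x ^+ k) -> P x.
Proof.
move=> [_ nP1 PM]; elim: k => [|k IH]; first by rewrite expr0 => /nP1.
by rewrite exprS => /PM[].
Qed.

(** A minimal prime consists of zero divisors: the set of products [u x^k] with
[u] outside [P] does not contain [0], and a prime missing it is inside [P]
without containing [x]. *)
Lemma prime_below_regular P x : prime_ideal P -> P x -> GRing.lreg x ->
  exists2 q, prime_ideal q & q `<` P.
Proof.
move=> [idP nP1 PM] Px regx.
have id0 : is_ideal [set x | exists r : T, x = r * 0] by exact: multiples_ideal.
pose S := [set y : T | exists u k, ~ P u /\ y = u * x ^+ k].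
have [|y z [u [k [nPu ->]]] [v [l [nPv ->]]]||q [prq _ qS]] := prime_of_mult_closed (S := S) id0.
- by exists 1, 0; rewrite mulr1.
- exists (u * v), (k + l)%N; rewrite exprD; split; last by ring.
  by move=> /PM[].
- apply/seteqP; split=> // y [[r ->] [u [k [nPu]]]].
  rewrite mulr0 mulrC => /esym/(lreg_eq0 (GRing.lregX (n := k) regx)) u0.
  by apply: nPu; rewrite u0; exact: ideal0.
have qSF y : q y -> S y -> False by move=> qy Sy; suff: set0 y by []; rewrite -qS.
exists q => //; split=> [y qy|Pq].
  apply: contrapT => nPy; apply: (qSF y qy).
  by exists y, 0; rewrite mulr1.
by apply: (qSF x); [exact: Pq|exists 1, 1; rewrite expr1 mul1r].
Qed.

Lemma dim1_no_chain P q : has_krull_dim T 1 ->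
  prime_ideal q -> prime_ideal P -> q `<` P -> ~ P `<` m.
Proof.
move=> [_ dim] prq prP qP Pm.
pose chain i := if i is i'.+1 then if i' is _.+1 then m else P else q.
suff /dim : prime_chain chain 2 by [].
split=> [[|[|i]] _|[|[|i]]] //; exact: local_prime.
Qed.

(** If [x, y] is a regular sequence then no power of [y] is in [(x)], and some
prime contains [x] but not [y].  It is neither minimal nor maximal, against
dimension one. *)
Lemma regular_seq_size s : has_krull_dim T 1 ->
  regular_sequence s -> [set` s] `<=` m -> (size s <= 1)%N.
Proof.
move=> dim [regs ns1] sm; rewrite leqNgt; apply/negP.
case: s regs ns1 sm => [|x [|y s]] // regs ns1 sm _.
have mx : m x by apply: sm; rewrite /= inE eqxx.
have my : m y by apply: sm; rewrite /= !inE eqxx orbT.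
have regx : GRing.lreg x.
  apply: lregP0 => z xz; apply: ideal_gen_nil; apply: (regs 0) => //=.
  by rewrite xz; exact: (ideal0 (ideal_genP _)).
have regy z : principal x (y * z) -> principal x z.
  by have := regs 1%N isT z; rewrite /= ideal_gen_seq1.
have nx1 : ~ principal x 1.
  by move=> x1; apply: ns1; move: x1; apply: sub_smallest2r; [exact: ideal_genP|move=> _ ->; rewrite /= inE eqxx].
have nyx k : ~ principal x (y ^+ k).
  by elim: k => [|k IH]; rewrite ?expr0 // exprS => /regy.
have [|z w [k ->] [l ->]||P [prP xP Py]] :=
    prime_of_mult_closed (S := [set z | exists k, z = y ^+ k]) (ideal_genP [set x]).
- by exists 0; rewrite expr0.
- by exists (k + l)%N; rewrite exprD.
- by apply/seteqP; split=> // z [xz [k zE]]; apply: (nyx k); rewrite -zE.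
have Px : P x by apply: xP; exact: mem_ideal_gen.
have [q prq qP] := prime_below_regular prP Px regx.
apply: (dim1_no_chain dim prq prP qP); have [idP nP1 _] := prP.
split; first exact: proper_ideal_sub.
move=> /(_ _ my) Py1; suff: set0 y by [].
by rewrite -Py; split=> //; exists 1; rewrite expr1.
Qed.

Lemma cohen_macaulay_dim1 x : has_krull_dim T 1 -> m x -> GRing.lreg x ->
  cohen_macaulay_local m.
Proof.
move=> dim mx regx; split=> //; exists 1; split=> //; split.
  exists [:: x]; split=> [|y /=|//]; last by rewrite inE => /eqP->.
  split=> [[|//] _ y|/=].
    rewrite /= => /ideal_gen_nil/(lreg_eq0 regx)->.
    exact: (ideal0 (ideal_genP _)).
  rewrite ideal_gen_seq1 => /principalP[r].
  by move=> rE; apply: (local_proper locT); rewrite rE; apply: (ideal_scalel _ (local_ideal locT)).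
by move=> s; exact: regular_seq_size.
Qed.

Lemma cohen_macaulay_regular : cohen_macaulay_local m -> has_krull_dim T 1 ->
  exists2 x, m x & GRing.lreg x.
Proof.
move=> [_ [d [[[Pd chd] dimd] [[s [[regs _] sm sd]] _]]]] [[P1 ch1] dim1].
have d1 : d = 1%N by apply/eqP; rewrite eqn_leq (dim1 _ _ chd) (dimd _ _ ch1).
case: s regs sm sd => [|x [|]] regs sm; rewrite d1 // => _.
exists x; first by apply: sm; rewrite /= inE.
apply: lregP0 => z xz; apply: ideal_gen_nil; apply: (regs 0) => //=.
by rewrite xz; exact: (ideal0 (ideal_genP _)).
Qed.

(** The reduction [a] is regular because [(a)] is [m]-primary, so that a power of
the regular element [x] is a multiple of [a]. *)
Lemma ulrich_with_of_ideal I x : m x -> GRing.lreg x -> ulrich_ideal m I ->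
  exists a, ulrich_with m I a.
Proof.
move=> mx regx [[[idI nI1 _] radI] [a [[[[_ rada] _] [aI _]] Ia sqI frI]]].
have Iaa : I a by apply: aI; exact: mem_ideal_gen.
exists a; split=> //.
- exact: (proper_ideal_sub locT idI nI1).
- by rewrite radI.
- have [k /principalP[r xE]] : radical (principal a) x by rewrite rada.
  by apply: (lreg_mulr (r := r)); rewrite -xE; exact: GRing.lregX.
- move=> y z Iy Iz; have : ideal_pow I 2 (y * z) by exact: mem_sqr.
  rewrite sqI; have le : ideal_mul (principal a) I `<=` [set x | exists2 z, I z & x = a * z].
    apply: ideal_mul_le; first exact: scaled_ideal.
    move=> _ w /principalP[r ->] Iw; exists (r * w); first exact: ideal_scalel.
    by ring.
  exact: le.
- move=> Ile; apply: Ia; apply/seteqP; split=> // y /Ile[r ->].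
  by apply/principalP; exists r.
Qed.

Lemma ulrich_ideal_of_with I a : has_krull_dim T 1 -> ulrich_with m I a ->
  ulrich_ideal m I.
Proof.
move=> dim uI; have [idI Im mI Ia rega Isq nprinc frI] := uI.
have aI : principal a `<=` I by apply: ideal_gen_le => // _ ->.
have sqE : ideal_pow I 2 = ideal_mul (principal a) I.
  apply/seteqP; split.
    apply: sqr_le => //; first exact: ideal_mulP.
    move=> x y Ix Iy; have [z Iz ->] := Isq _ _ Ix Iy.
    by apply: mem_ideal_mul => //; exact: mem_ideal_gen.
  apply: ideal_mul_le; first exact: sqr_ideal.
  by move=> x y /aI Ix Iy; exact: mem_sqr.
split; first exact: (primary_of_radical locT).
exists a; split=> //.
- split; last by split=> //; exists 1%N; rewrite ideal_pow1.
  split; last by exists [:: a]; rewrite ideal_gen_seq1.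
  apply: (primary_of_radical locT); first exact: ideal_genP.
    exact: subset_trans Im.
  move=> x /mI[k Ixk]; exists (k + k)%N; rewrite exprD.
  have [z Iz ->] := Isq _ _ Ixk Ixk.
  by apply/principalP; exists z; rewrite mulrC.
- by move=> IE; apply: nprinc; rewrite IE => x /principalP.
Qed.

End DimensionOne.

(** * The overring B and its numerators *)

(** The ring [B = J : J] is [J/b], and [num x] is the numerator [bx].  Only the
ring structure that it induces on [J] matters, so [B] is kept abstract. *)
Record numerator_map (R B : comNzRingType) (J : set R) (b : R) (num : B -> R) : Prop :=
  NumeratorMap {
    nm_reg : GRing.lreg b;
    nm_D : forall x y, num (x + y) = num x + num y;
    nm_M : forall x y, b * num (x * y) = num x * num y;
    nm_1 : num 1 = b;
    nm_inj : injective num;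
    nm_in : forall x, J (num x);
    nm_onto : forall j, J j -> exists x, num x = j }.

Section Overring.
Context {R B : comNzRingType} {J : set R} {b : R} {num : B -> R}.
Hypothesis nm : numerator_map J b num.
Hypothesis idJ : is_ideal J.
Implicit Types (r t : R) (x y z w : B).

Let regb : GRing.lreg b. Proof. exact: nm_reg nm. Qed.

Lemma num0 : num 0 = 0.
Proof. by apply: (addrI (num 0)); rewrite -(nm_D nm) !addr0. Qed.

Lemma numN x : num (- x) = - num x.
Proof. by apply: (addrI (num x)); rewrite -(nm_D nm) !subrr num0. Qed.

Lemma numB x y : num (x - y) = num x - num y.
Proof. by rewrite (nm_D nm) numN. Qed.

Lemma num_sum n (F : 'I_n -> B) : num (\sum_(i < n) F i) = \sum_(i < n) num (F i).
Proof.
by apply: (big_morph num); [exact: (nm_D nm)|exact: num0].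
Qed.

Lemma Jb : J b. Proof. by rewrite -(nm_1 nm); exact: (nm_in nm). Qed.

Lemma sqr_sub_num : sqr_sub b J.
Proof.
move=> j k /(nm_onto nm)[x <-] /(nm_onto nm)[y <-].
by exists (num (x * y)); rewrite ?(nm_M nm) //; exact: (nm_in nm).
Qed.

Fact emb_ex r : exists x, num x = r * b.
Proof. by apply: (nm_onto nm); apply: ideal_scalel idJ Jb. Qed.

(** The structure map from [R] to [B], recovered from numerators. *)
Definition emb r : B := sval (cid (emb_ex r)).

Lemma num_emb r : num (emb r) = r * b.
Proof. by rewrite /emb; case: cid. Qed.

Lemma num_embM r x : num (emb r * x) = r * num x.
Proof. by apply: regb; rewrite /= (nm_M nm) num_emb; ring. Qed.

Lemma embM r t : emb (r * t) = emb r * emb t.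
Proof. by apply: (nm_inj nm); rewrite num_embM !num_emb mulrA. Qed.

Lemma embD r t : emb (r + t) = emb r + emb t.
Proof. by apply: (nm_inj nm); rewrite (nm_D nm) !num_emb mulrDl. Qed.

Lemma emb1 : emb 1 = 1.
Proof. by apply: (nm_inj nm); rewrite num_emb (nm_1 nm) mul1r. Qed.

Lemma emb0 : emb 0 = 0.
Proof. by apply: (nm_inj nm); rewrite num_emb num0 mul0r. Qed.

Lemma embX r k : emb (r ^+ k) = emb r ^+ k.
Proof. by elim: k => [|k IH]; rewrite ?expr0 ?emb1 // !exprS embM IH. Qed.

Lemma emb_num x : emb (num x) = emb b * x.
Proof. by apply: (nm_inj nm); rewrite num_embM num_emb mulrC. Qed.

Lemma emb_lreg r : GRing.lreg r -> GRing.lreg (emb r).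
Proof.
move=> regr; apply: lregP0 => x /(congr1 num); rewrite num_embM num0.
by move=> /(lreg_eq0 regr); rewrite -num0 => /(nm_inj nm).
Qed.

Lemma preimage_ideal I : is_ideal I ->
  (forall j i, J j -> I i -> exists2 z, I z & j * i = b * z) -> is_ideal (num @^-1` I).
Proof.
move=> idI JI; split=> [|x y Ix Iy|y x Ix] /=.
- by rewrite num0; exact: ideal0.
- by rewrite (nm_D nm); exact: idealD.
- have [z Iz zE] := JI _ _ (nm_in nm y) Ix.
  suff -> : num (y * x) = z by [].
  by apply: regb; rewrite /= (nm_M nm).
Qed.

Lemma image_ideal (C : set B) : is_ideal C -> is_ideal (num @` C).
Proof.
move=> idC; split=> [|_ _ [x Cx <-] [y Cy <-]|r _ [x Cx <-]].
- by exists 0; [exact: ideal0|exact: num0].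
- by exists (x + y); [exact: idealD|exact: (nm_D nm)].
- by exists (emb r * x); [exact: ideal_scalel|exact: num_embM].
Qed.

Lemma image_preimage I : I `<=` J -> num @` (num @^-1` I) = I.
Proof.
move=> IJ; apply/seteqP; split=> [_ [x Ix <-] //|i Ii].
by have [x xE] := nm_onto nm (IJ _ Ii); exists x => //=; rewrite xE.
Qed.

Lemma noetherian_overring : noetherian R -> noetherian B.
Proof.
move=> noeR C idC; have [s sE] := noeR _ (image_ideal idC).
have [s' [s'C s'E]] : exists s' : seq B, [set` s'] `<=` C /\ map num s' = s.
  have : [set` s] `<=` num @` C by rewrite sE; exact: mem_ideal_gen.
  elim: s {sE} => [_|r s IH sC]; first by exists [::].
  have [|s' [s'C <-]] := IH; first by move=> x xs; apply: sC; rewrite /= inE xs orbT.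
  have [|c Cc <-] := sC r; first by rewrite /= inE eqxx.
  exists (c :: s'); split=> // x /=; rewrite inE => /orP[/eqP->//|xs]; exact: s'C.
exists s'; apply/seteqP; split; last exact: ideal_gen_le.
move=> x Cx; have idG := ideal_genP [set` s'].
have : (num @` C) (num x) by exists x.
rewrite sE; have le : ideal_gen [set` s] `<=` num @` (ideal_gen [set` s']).
  apply: ideal_gen_le; first exact: image_ideal.
  rewrite -s'E => _ /mapP[y ys ->]; exists y => //; exact: mem_ideal_gen.
by move=> /le[y Gy /(nm_inj nm) <-].
Qed.

Lemma contraction_prime P : prime_ideal P -> prime_ideal (emb @^-1` P).
Proof.
move=> [idP nP1 PM]; split=> [||r t] /=.
- split=> [|r t Pr Pt|r t Pt] /=.
  + by rewrite emb0; exact: ideal0.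
  + by rewrite embD; exact: idealD.
  + by rewrite embM; exact: ideal_scalel.
- by rewrite emb1.
- by rewrite embM => /PM.
Qed.

(** The prime of [B] lying over a prime that does not contain [b]. *)
Lemma extension_prime P : prime_ideal P -> ~ P b -> prime_ideal (num @^-1` P).
Proof.
move=> [idP nP1 PM] nPb.
have Pnum x y : P (num (x * y)) <-> P (num x * num y).
  rewrite -(nm_M nm); split=> [|/PM[]//]; exact: ideal_scalel.
split=> [||x y] /=.
- split=> [|x y Px Py|y x Px] /=.
  + by rewrite num0; exact: ideal0.
  + by rewrite (nm_D nm); exact: idealD.
  + by apply/Pnum; exact: ideal_scalel.
- by rewrite (nm_1 nm).
- by move=> /Pnum/PM.
Qed.

End Overring.

(** * Transfer of Ulrich ideals along the overring *)

Section LocalOverring.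
Context {R B : comNzRingType} {m J : set R} {b : R} {num : B -> R}.
Hypothesis locR : local_ring m.
Hypothesis nm : numerator_map J b num.
Hypothesis idJ : is_ideal J.
Hypothesis Jm : J `<=` m.
Implicit Types (r t : R) (x y z w : B).

Let regb : GRing.lreg b. Proof. exact: nm_reg nm. Qed.
Let Jsq : sqr_sub b J. Proof. exact: sqr_sub_num nm. Qed.
Let JB : J b. Proof. exact: Jb nm. Qed.
Let idm : is_ideal m. Proof. exact: local_ideal locR. Qed.
Local Notation emb := (emb nm idJ).

Definition nonunits : set B := [set x | ~ exists y, y * x = 1].

Section OneUlrichIdeal.
Context {I : set R} {a : R}.
Hypothesis uI : ulrich_with m I a.
Hypothesis IJ : I `<=` J.
Hypothesis nJI : ~ J `<=` I.

Let idI : is_ideal I. Proof. exact: uw_ideal uI. Qed.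
Let JI : forall j i, J j -> I i -> exists2 z, I z & j * i = b * z.
Proof. exact: (nested_mul locR uI idJ IJ regb Jsq). Qed.
Let Jspan : forall j, J j -> exists r i, I i /\ j = r * b + i.
Proof. exact: (nested_span locR uI idJ IJ regb Jsq). Qed.

Let nIb : ~ I b.
Proof.
move=> Ib; apply: nJI => j /Jspan[r [i [Ii ->]]].
by apply: idealD => //; exact: ideal_scalel.
Qed.

Let I_reduction : exists s, [/\ m s, I (b * s) & sqr_sub (b * s) I].
Proof.
have [s [Ibs Isq]] := nested_reduction locR uI idJ IJ Jm JB regb Jsq.
exists s; split=> //; apply: contrapT => /(unit_of_notin locR)[s' ss].
by apply: nIb; rewrite -[b]mulr1 -ss mulrCA; exact: ideal_scalel.
Qed.

Lemma overring_ideal : is_ideal (num @^-1` I).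
Proof. exact (preimage_ideal nm idI JI). Qed.

Lemma overring_span x : exists r k, [/\ I (num k), x = emb r + k & num x = r * b + num k].
Proof.
have [r [i [Ii xE]]] := Jspan (nm_in nm x).
exists r, (x - emb r); rewrite (numB nm) num_emb xE addrC addKr; split=> //; ring.
Qed.

(** That is, the nonunits are [m + I/b].  An element [r + i/b] with [r] a unit is
invertible by [nested_change]. *)
Lemma nonunitsP x : nonunits x <-> exists r i, [/\ m r, I i & num x = r * b + i].
Proof.
have [s [ms Ibs Isq]] := I_reduction; split=> [nx|[r [i [mr Ii xE]]] [y yx]].
- have [r [i [Ii xE]]] := Jspan (nm_in nm x).
  exists r, i; split=> //; apply: contrapT => /(unit_of_notin locR)[r' rr].
  apply: nx.
  have numsq := nested_change locR idI idJ IJ JB regb Jsq JI ms Isq rr Ii xE.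
  have [j Jj jE] := numsq _ _ JB JB.
  have [y yE] := nm_onto nm Jj; exists y; apply: (nm_inj nm); apply: regb.
  by rewrite /= (nm_M nm) (nm_1 nm) jE yE mulrC.
- have [t [k [Ik yE]]] := Jspan (nm_in nm y).
  have [z Iz zE] := JI (nm_in nm y) Ii.
  have bE : b = r * num y + z.
    apply: regb; rewrite -{2}(nm_1 nm) -yx /= (nm_M nm) xE mulrDr -/b mulrDr zE mulrA.
    by rewrite (mulrC (num y)) mulrA (mulrC b); ring.
  have [|u uE] := unit_of_notin locR (r := 1 - r * t).
    by apply: one_sub_notin => //; exact: ideal_scaler.
  apply: nIb; rewrite -[b]mul1r -uE -mulrA; apply: ideal_scalel => //.
  have -> : (1 - r * t) * b = r * k + z.
    by rewrite mulrBl mul1r {1}bE yE; ring.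
  by apply: idealD => //; exact: ideal_scalel.
Qed.

Lemma local_overring : local_ring nonunits.
Proof.
have [noeR _ _] := locR.
have idn : is_ideal nonunits.
  split=> [|x y /nonunitsP[r [i [mr Ii xE]]] /nonunitsP[t [j [mt Ij yE]]]|].
  - by move=> [y]; rewrite mulr0 => /esym/eqP; rewrite oner_eq0.
  - apply/nonunitsP; exists (r + t), (i + j); rewrite (nm_D nm) xE yE.
    by split; [exact: idealD|exact: idealD|ring].
  - by move=> y x nx [z zE]; apply: nx; exists (z * y); rewrite -mulrA.
have n1 : ~ nonunits 1 by move=> /(_ _); apply; exists 1; rewrite mul1r.
have sub_n I' : is_ideal I' -> ~ I' 1 -> I' `<=` nonunits.
  by move=> idI' nI1 x I'x [y yx]; apply: nI1; rewrite -yx; exact: ideal_scalel.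
split; first exact: (noetherian_overring nm idJ).
- split=> // I' idI' nI1 nI'; apply/seteqP; split=> //; exact: sub_n.
- by move=> m' [idm' nm1 maxm']; rewrite (maxm' _ idn n1 (sub_n _ idm' nm1)).
Qed.

Let locB := local_overring.

Lemma radical_b r : m r -> exists k t, r ^+ k = t * b.
Proof.
have [s [ms Ibs Isq]] := I_reduction.
move=> /(uw_rad uI)[k Irk]; have [z Iz zE] := Isq _ _ Irk Irk.
by exists (k + k)%N, (s * z); rewrite exprD zE; ring.
Qed.

Lemma emb_nonunit r : m r -> nonunits (emb r).
Proof.
move=> mr; apply/nonunitsP; exists r, 0.
by rewrite num_emb addr0; split=> //; exact: ideal0.
Qed.

Lemma sqr_numI k : I (num k) -> exists s y, m s /\ k * k = emb s * y.
Proof.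
have [s [ms Ibs Isq]] := I_reduction.
move=> Ik; have [z Iz zE] := Isq _ _ Ik Ik.
have [y yE] := nm_onto nm (IJ Iz); exists s, y; split=> //.
apply: (nm_inj nm); rewrite num_embM yE; apply: regb.
by rewrite /= (nm_M nm) zE mulrA.
Qed.

(** The radical of [bR] is [m], and the elements of [I/b] have their squares in
[mB]. *)
Lemma prime_mem_b P : prime_ideal P -> P (emb b) -> P = nonunits.
Proof.
move=> prP Pb; have [idP nP1 PM] := prP.
apply/seteqP; split; first exact: (proper_ideal_sub locB).
have Pm r : m r -> P (emb r).
  move=> /radical_b[k [t rk]]; apply: (prime_pow (k := k)) => //.
  by rewrite -embX rk embM; exact: ideal_scalel.
move=> x nx; have [r [k [Ik xE numE]]] := overring_span x.
have [r' [i' [mr' Ii' xE']]] := (nonunitsP x).1 nx.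
have mr : m r.
  apply: contrapT => /(unit_of_notin locR (r := r))nmr.
  have nmr' : ~ m (r - r').
    move=> mrr; case: nmr => u ur; apply: (local_proper locR); rewrite -ur.
    apply: ideal_scalel => //; exact: (ideal_eq_of_diff idm mrr).
  case/(unit_of_notin locR): nmr' => u ur; apply: nIb.
  rewrite -[b]mul1r -ur -mulrA; apply: ideal_scalel => //.
  have -> : (r - r') * b = i' - num k by rewrite -[i'](addKr (r' * b)) -xE' numE; ring.
  exact: idealB.
rewrite xE; apply: idealD => //; first exact: Pm.
have [s [y [ms kk]]] := sqr_numI Ik.
by apply: (prime_pow (k := 2)) => //; rewrite expr2 kk; apply: ideal_scaler => //; exact: Pm.
Qed.

(** Primes of [B] other than the maximal one do not contain [b], and since
[b x] is in [R] for [x] in [B] they are determined by their contractions.  Hence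
a chain of length two in [B] contracts to a chain of two primes strictly below
[m]. *)
Lemma dim_overring : has_krull_dim R 1 -> has_krull_dim B 1.
Proof.
move=> dimR; have [[Q [prQ chQ]] _] := dimR; split.
- have nQb : ~ Q 0 b.
    move=> Qb; have [Q01 nQ10] := chQ 0 isT; apply: nQ10 => r Q1r.
    have [idQ1 nQ11 _] := prQ 1%N isT.
    have [k [t rk]] := radical_b (proper_ideal_sub locR idQ1 nQ11 Q1r).
    apply: (prime_pow (k := k)) (prQ 0 isT) _; rewrite rk.
    by apply: ideal_scalel => //; case: (prQ 0 isT).
  have prP0 := extension_prime nm (prQ 0 isT) nQb.
  exists (fun k => if k is 0%N then num @^-1` (Q 0) else nonunits); split.
    by case=> // k _; exact: (local_prime locB).
  case=> // _; split; first by have [? ? _] := prP0; exact: (proper_ideal_sub locB).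
  move=> /(_ (emb b) (emb_nonunit (Jm JB))) /=; rewrite num_emb.
  by have [_ _ /[apply]] := prQ 0 isT; case.
- move=> P n [prP chP]; rewrite leqNgt; apply/negP => n2.
  have pr k : (k <= 2)%N -> prime_ideal (P k) by move=> k2; apply: prP; exact: leq_trans n2.
  have [P01 nP10] : P 0 `<` P 1%N by apply: chP; exact: leq_trans n2.
  have [P12 nP21] : P 1%N `<` P 2 by apply: chP.
  have nPb : ~ P 1%N (emb b).
    move=> Pb; apply: nP21; rewrite (prime_mem_b (pr 1%N isT) Pb).
    by have [? ? _] := pr 2 isT; exact: (proper_ideal_sub locB).
  have prp k : (k <= 2)%N -> prime_ideal (emb @^-1` (P k)).
    by move=> k2; apply: contraction_prime; exact: pr.
  apply: (dim1_no_chain locR dimR (prp 0 isT) (prp 1%N isT)).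
    split=> [r /P01//|p10]; apply: nP10 => x P1x.
    have : P 0 (emb (num x)).
      by apply: p10; rewrite /= emb_num; apply: ideal_scalel => //; case: (pr 1%N isT).
    by rewrite emb_num; have [_ _ /[apply]] := pr 0 isT; case=> // /P01.
  split; last by move=> /(_ _ (Jm JB)).
  by have [? ? _] := prp 1%N isT; exact: (proper_ideal_sub locR).
Qed.

(** With [I^2 = bsI] and [K = I/b], the reduction of [K] is [s].  For freeness,
the numerator of a relation between the [x_i/b] over [B/K] has coefficients in
[J = bR + I]; their parts in [I] only contribute to [sI], and multiplying by [b]
gives a relation in [I/I^2]. *)
Lemma overring_ulrich : exists c, ulrich_with nonunits (num @^-1` I) c.
Proof.
have [s [ms Ibs Isq]] := I_reduction.
have idK := overring_ideal; have Ibs' : I (num (emb s)) by rewrite num_emb mulrC.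
have Ksq : sqr_sub (emb s) (num @^-1` I).
  move=> x y /= Ix Iy; have [z Iz zE] := Isq _ _ Ix Iy.
  have [w wE] := nm_onto nm (IJ Iz); exists w; first by rewrite /= wE.
  apply: (nm_inj nm); apply: regb.
  by rewrite /= (nm_M nm) num_embM wE zE mulrA.
have uIbs := ulrich_change uI Ibs Isq.
have regs : GRing.lreg s.
  by have := uw_reg uIbs; apply: lreg_mulr.
exists (emb s); split=> //.
- move=> x Ix; apply/nonunitsP; exists 0, (num x).
  by rewrite mul0r add0r; split=> //; exact: ideal0.
- move=> x /nonunitsP[r [i [mr Ii xE]]]; have [k Irk] := uw_rad uI mr.
  have [z zE] := nm_onto nm (IJ Ii); have xrz : x = emb r + z.
    by apply: (nm_inj nm); rewrite (nm_D nm) num_emb zE.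
  have Kz : (num @^-1` I) z by rewrite /= zE.
  exists k; have [w ->] : exists w, x ^+ k = emb r ^+ k + w * z.
    rewrite xrz; elim: k {Irk} => [|k [w IH]]; first by exists 0; rewrite !expr0; ring.
    by exists (emb r ^+ k + w * (emb r + z)); rewrite !exprS IH; ring.
  apply: (idealD idK); last exact: (ideal_scalel _ idK).
  by rewrite -embX /= num_emb; exact: ideal_scaler.
- exact: emb_lreg.
- move=> Kprinc; apply: nJI => j Jj; apply: (ulrich_colon locR uIbs) => i Ii.
  have [x xE] := nm_onto nm (IJ Ii).
  have [|y yE] := Kprinc x; first by rewrite /= xE.
  have [k Jk kE] := Jsq Jj (nm_in nm y).
  exists k; have -> : i = s * num y by rewrite -xE yE mulrC num_embM.
  by rewrite mulrCA kE; ring.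
- have [n [x [Ix gen indep]]] := uw_free uI.
  have /choice[X XE] : forall i, exists y, num y = x i.
    by move=> i; apply: (nm_onto nm); exact: IJ.
  have sqK y : ideal_pow (num @^-1` I) 2 y <-> exists2 z, (num @^-1` I) z & y = emb s * z.
    exact: sqr_memP.
  have sqI r : ideal_pow I 2 r <-> exists2 t, I t & r = b * s * t by exact: sqr_memP.
  exists n, X; split=> [i|y /= Iy|C].
  + by rewrite /= XE.
  + have [c /sqI[z Iz cE]] := gen _ Iy; exists (fun i => emb (c i)); apply/sqK.
    have [w wE] := nm_onto nm (ideal_scalel b idJ (IJ Iz)).
    exists w; first by rewrite /= wE; exact: ideal_scalel.
    apply: (nm_inj nm); rewrite (numB nm) (num_sum nm) num_embM wE.
    by under eq_bigr do rewrite num_embM XE; rewrite cE; ring.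
  + move=> /sqK[w Kw CE].
    have /choice[c cE] : forall i, exists c, exists2 z, I z & num (C i * X i) = c * x i + s * z
         /\ I (num (C i) - c * b).
      move=> i; have [c [k [Ik _ numE]]] := overring_span (C i).
      have [z Iz zE] := Isq _ _ Ik (Ix i).
      exists c, z => //; split; last by rewrite numE addrC addKr.
      by apply: regb; rewrite /= (nm_M nm) XE numE mulrDl zE; ring.
    have /indep bcI : ideal_pow I 2 (\sum_(i < n) (b * c i) * x i).
      have /choice[z zE] : forall i, exists t, I t /\ num (C i * X i) = c i * x i + s * t.
        by move=> i; have [z Iz [E _]] := cE i; exists z.
      apply/sqI; exists (num w - \sum_(i < n) z i).
        apply: idealB => //; apply: (ideal_sum _ idI) => i _; by have [] := zE i.
      have : num (\sum_(i < n) C i * X i) = s * num w by rewrite CE num_embM.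
      rewrite (num_sum nm) (eq_bigr (fun i => c i * x i + s * z i)); last first.
        by move=> i _; have [] := zE i.
      rewrite big_split /= -mulr_sumr => E.
      under eq_bigr do rewrite -mulrA.
      rewrite -mulr_sumr.
      have -> : \sum_(i < n) c i * x i = s * num w - s * \sum_(i < n) z i by rewrite -E; ring.
      by ring.
    move=> i /=; have [z _ [_ /(ideal_eq_of_diff idI)]] := cE i; apply.
    by rewrite mulrC.
Qed.

(** The facts on nested ideals are applied in [B] to [I/b] and [C]: they give
[C = tB + I/b] and the reduction [tu] of [I/b].  As [B = R + I/b], both [t] and [u]
may be moved into [R]. *)
Lemma image_ulrich (C : set B) (t : B) : ~ (J `<=` [set x | exists r, x = r * b]) ->
  ulrich_with nonunits C t -> num @^-1` I `<=` C ->
  ~ C `<=` num @^-1` I -> exists e, ulrich_with m (num @` C) e.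
Proof.
move=> Jnprinc uC KC nCK; have idK := overring_ideal; have idC := uw_ideal uC.
have [g uK] := overring_ulrich; have nC := uw_sub uC.
have CK := nested_mul locB uK idC KC (uw_reg uC) (uw_sqr uC).
have [u [Ktu Ksq]] := nested_reduction locB uK idC KC nC (uw_mem uC) (uw_reg uC) (uw_sqr uC).
have nu : nonunits u.
  move=> [u' uu]; apply: nCK => x.
  move=> /(nested_span locB uK idC KC (uw_reg uC) (uw_sqr uC))[y [k [Kk ->]]].
  apply: (idealD idK) => //; rewrite -[t]mulr1 -uu; apply: (ideal_scalel _ idK).
  by rewrite mulrCA; apply: (ideal_scalel _ idK).
have [r [k [Kk tE _]]] := overring_span t.
have Cr : C (emb r).
  have -> : emb r = t - k by rewrite tE addrK.
  by apply: idealB => //; [exact: (uw_mem uC)|exact: KC].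
(* [t] and its component [r] in [R] differ by an element of [I/b]. *)
have rsq : sqr_sub (emb r) C.
  apply: (nested_change locB idK idC KC (uw_mem uC) (uw_reg uC) (uw_sqr uC) CK nu Ksq
    (s := 1) (s' := 1) (i := - k)); first by rewrite mulr1.
    exact: (idealN idK).
  by rewrite tE; ring.
have regr := sqr_sub_lreg (uw_mem uC) (uw_reg uC) rsq.
have [u' [Kru' Ksq']] := nested_reduction locB uK idC KC nC Cr regr rsq.
have [v [k' [Kk' u'E _]]] := overring_span u'.
have Krv : (num @^-1` I) (emb r * emb v).
  have -> : emb r * emb v = emb r * u' - emb r * k' by rewrite u'E; ring.
  by apply: (idealB idK) => //; exact: (ideal_scalel _ idK).
(* Replacing [u'] by its component [v] in [R] moves the reduction by an element
   of [n (I/b)], where [n] is the maximal ideal of [B]. *)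
have Ksqrv : sqr_sub (emb r * emb v) (num @^-1` I).
  apply: (ulrich_perturb locB (ulrich_change uK Kru' Ksq')) => //.
  have -> : emb r * emb v - emb r * u' = emb r * - k' by rewrite u'E; ring.
  by apply: mem_ideal_mul; [exact: nC|exact: (idealN idK)].
have idA := image_ideal nm idJ idC.
have IA : I `<=` num @` C.
  by rewrite -(image_preimage nm IJ) => _ [x Kx <-]; exists x => //; exact: KC.
have Ae : (num @` C) (r * b) by exists (emb r) => //; rewrite num_emb.
have Asq : sqr_sub (r * b) (num @` C).
  move=> _ _ [x Cx <-] [y Cy <-]; have [z Cz zE] := rsq _ _ Cx Cy.
  by exists (num z); [exists z|rewrite -(nm_M nm) zE num_embM; ring].
have Iev : I (r * b * v) by have := Krv; rewrite /= num_embM num_emb => ?; rewrite mulrAC -mulrA.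
have Isqev : sqr_sub (r * b * v) I.
  move=> _ _ /[dup] /IJ /(nm_onto nm)[x <-] Ix /[dup] /IJ /(nm_onto nm)[y <-] Iy.
  have [z Kz zE] := Ksqrv _ _ Ix Iy.
  by exists (num z) => //; rewrite -(nm_M nm) zE -mulrA !num_embM; ring.
have regev := uw_reg (ulrich_change uI Iev Isqev).
have rege : GRing.lreg (r * b) by apply: (lreg_mulr (r := v)); rewrite mulrC.
exists (r * b); split=> //.
- by move=> _ [x Cx <-]; apply: Jm; exact: (nm_in nm).
- by move=> y /(uw_rad uI)[l Iyl]; exists l; exact: IA.
- move=> Aprinc; apply: Jnprinc => _ /(nm_onto nm)[x <-].
  have [|l lE] := Aprinc (num (emb r * x)).
    by exists (emb r * x) => //; exact: ideal_scaler.
  exists l; have regr' : GRing.lreg r by apply: (lreg_mulr (r := b)); rewrite mulrC.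
  by apply: regr'; rewrite -(num_embM nm idJ) lE; ring.
- apply: (nested_conormal_free locR uI idA IA Ae Asq _ Iev Isqev).
  move=> _ [x Cx <-]; have [y [l [Kl ->]]] := nested_span locB uK idC KC regr rsq Cx.
  have [w [p [Ip -> _]]] := overring_span y.
  exists w, (num (emb r * p + l)); split; last first.
    by rewrite -(num_emb nm idJ) -(num_embM nm idJ) -(nm_D nm); congr num; ring.
  by apply: (idealD idK) => //; exact: (ideal_scalel _ idK).
Qed.

End OneUlrichIdeal.
End LocalOverring.

(** * The correspondence *)

(** Let [J^2 = cJ].  Both [b] and [c] generate [J] modulo [I], so that [b] is a
unit multiple of [c] modulo [I]. *)
Lemma nested_generator (R : comNzRingType) (m I J : set R) a c b :
  local_ring m -> ulrich_with m I a -> ulrich_with m J c -> I `<=` J -> ~ J `<=` I ->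
  J b -> (forall j, J j -> exists r i, I i /\ j = r * b + i) -> ulrich_with m J b.
Proof.
move=> locR uI uJ IJ nJI Jb Jspan.
have [idI idJ] := (uw_ideal uI, uw_ideal uJ).
have [Jc regc Jsq] := And3 (uw_mem uJ) (uw_reg uJ) (uw_sqr uJ).
have JI := nested_mul locR uI idJ IJ regc Jsq.
have cspan := nested_span locR uI idJ IJ regc Jsq.
have nIc : ~ I c.
  move=> Ic; apply: nJI => j /cspan[r [i [Ii ->]]].
  by apply: idealD => //; exact: ideal_scalel.
have [r [Icr Isq]] := nested_reduction locR uI idJ IJ (uw_sub uJ) Jc regc Jsq.
(* If [r] were a unit, [c] would be in [I]. *)
have mr : m r.
  apply: contrapT => /(unit_of_notin locR)[r' rr]; apply: nIc.
  by rewrite -[c]mulr1 -rr mulrCA; exact: ideal_scalel.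
have [s [i [Ii bE]]] := cspan _ Jb.
have ns : ~ m s.
  move=> ms; have [t [k [Ik cE]]] := Jspan _ Jc.
  have [|v vE] := unit_of_notin locR (r := 1 - t * s).
    by apply: one_sub_notin => //; apply: ideal_scalel => //; exact: local_ideal locR.
  apply: nIc; rewrite -[c]mul1r -vE -mulrA; apply: ideal_scalel => //.
  have -> : (1 - t * s) * c = t * i + k by rewrite mulrBl mul1r {1}cE bE; ring.
  by apply: idealD => //; exact: ideal_scalel.
have [s' ss] := unit_of_notin locR ns.
apply: (ulrich_change uJ Jb).
exact: (nested_change locR idI idJ IJ Jc regc Jsq JI mr Isq ss Ii bE).
Qed.

(** [J : J = J/b] because [J^2 = bJ] and [b] is regular. *)
Lemma colon_ring_numerator (R : comNzRingType) (Q : comUnitRingType)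
    (iota : {rmorphism R -> Q}) (J : ideal R) (b : R) :
  total_fraction_ring iota -> ideal_set J b -> GRing.lreg b -> sqr_sub b J ->
  exists num : colon_ring iota J -> R,
    numerator_map J b num /\ forall x, val x = iota (num x) / iota b.
Proof.
move=> [injiota unitiota _] Jb regb Jsq; have ub := unitiota _ regb.
have /choice[num numE] : forall x : colon_ring iota J,
    exists r, ideal_set J r /\ iota r = val x * iota b.
  move=> x; have /asboolP xJ := valP x.
  by have [|r Jr rE] := xJ (iota b); [exists b|exists r].
have numi x : iota (num x) = val x * iota b by have [] := numE x.
exists num; split=> [|x]; last by rewrite numi mulrK.
split=> //.
- by move=> x y; apply: injiota; rewrite rmorphD !numi -mulrDl.
- move=> x y; apply: injiota; rewrite !rmorphM !numi.
  rewrite -[val (x * y)]/(val x * val y); ring.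
- by apply: injiota; rewrite numi -[val 1]/(1 : Q) mul1r.
- move=> x y /(congr1 iota); rewrite !numi => /(mulIr ub); exact: val_inj.
- by move=> x; have [] := numE x.
- move=> j Jj; have jP : iota j / iota b \in colon_pred iota J.
    apply/asboolP => _ [y Jy <-]; have [z Jz zE] := Jsq _ _ Jj Jy.
    exists z => //; apply: (mulIr ub).
    by rewrite -rmorphM mulrAC mulrVK // -rmorphM zE mulrC.
  exists (Sub (iota j / iota b) jP : colon_ring iota J).
  by apply: injiota; rewrite numi SubK mulrVK.
Qed.

Theorem theorem1p4 (R : comNzRingType) (m : set R)
    (Q : comUnitRingType) (iota : {rmorphism R -> Q})
    (I J : ideal R) (b : R) :
  cohen_macaulay_local m -> has_krull_dim R 1 ->
  total_fraction_ring iota ->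
  ulrich_ideal m I -> ulrich_ideal m J -> I `<` J ->
  m b -> ideal_set J = ideal_add (principal b) I ->
  let B : comNzRingType := colon_ring iota J in
  let inB : B -> Q := val in
  exists n : set B,
    [/\ cohen_macaulay_local n, has_krull_dim B 1,
        exists2 c : set B, ulrich_ideal n c & inB @` c = ideal_frac iota I b
      & set_bij
          [set a : set R | [/\ ulrich_ideal m a, I `<=` a & a `<` J]]
          [set inB @` c | c in [set c : set B |
             ulrich_ideal n c /\ ideal_frac iota I b `<=` inB @` c]]
          (fun a => ideal_frac iota a b)].
Proof.
move=> cmR dimR fracQ ulI ulJ [IJ nJI] _ JE B inB.
have locR : local_ring m by case: cmR.
have [x0 mx0 regx0] := cohen_macaulay_regular cmR dimR.
have [a uI] := ulrich_with_of_ideal locR mx0 regx0 ulI.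
have [c uJc] := ulrich_with_of_ideal locR mx0 regx0 ulJ.
have Jb : ideal_set J b.
  rewrite JE; exists b; first exact: mem_ideal_gen.
  by exists 0; rewrite ?addr0 //; exact: ideal0 (uw_ideal uI).
have Jspan j : ideal_set J j -> exists r i, ideal_set I i /\ j = r * b + i.
  by rewrite JE => -[_ /principalP[r ->] [i Ii <-]]; exists r, i.
have uJ := nested_generator locR uI uJc IJ nJI Jb Jspan.
have [idJ Jm] := (uw_ideal uJ, uw_sub uJ).
have [num [nm valE]] := colon_ring_numerator fracQ Jb (uw_reg uJ) (uw_sqr uJ).
have ub : iota b \is a GRing.unit by case: fracQ => _ /(_ b (uw_reg uJ)).
have ubV : (iota b)^-1 \is a GRing.unit by rewrite unitrV.
have injiota : injective iota by case: fracQ.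
have fracE A : A `<=` ideal_set J -> ideal_frac iota A b = inB @` (num @^-1` A).
  move=> AJ; apply/seteqP; split=> [_ [z Az <-]|_ [x Ax <-]].
    have [x xE] := nm_onto nm (AJ _ Az).
    by exists x; rewrite /= ?xE // /inB valE xE.
  by exists (num x) => //; rewrite /inB valE.
pose n := nonunits (B := B).
have locB : local_ring n := local_overring locR nm idJ Jm uI IJ nJI.
have dimB : has_krull_dim B 1 := dim_overring locR nm idJ Jm uI IJ nJI dimR.
have nb : n (emb nm idJ b) := emb_nonunit locR Jm uI IJ nJI (Jm _ Jb).
have regb : GRing.lreg (emb nm idJ b) := emb_lreg (nm_reg nm).
have pull A a' : ulrich_with m A a' -> A `<=` ideal_set J -> ~ (ideal_set J `<=` A) ->
    ulrich_ideal n (num @^-1` A).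
  move=> uA AJ nJA.
  have [c' uc'] := overring_ulrich locR nm idJ Jm uA AJ nJA.
  exact (ulrich_ideal_of_with locB dimB uc').
exists n; split=> //.
- exact (cohen_macaulay_dim1 locB dimB nb regb).
- by exists (num @^-1` I); [exact (pull _ _ uI IJ nJI)|rewrite fracE].
split.
- move=> A [ulA IA [AJ nJA]]; have [a' uA] := ulrich_with_of_ideal locR mx0 regx0 ulA.
  exists (num @^-1` A); last by rewrite fracE.
  split; first exact (pull _ _ uA AJ nJA).
  by rewrite -fracE // => _ [i Ii <-]; exists i => //; exact: IA.
- have sub A A' : ideal_frac iota A b = ideal_frac iota A' b -> A `<=` A'.
    move=> AA' z Az; have : ideal_frac iota A b (iota z / iota b) by exists z.
    by rewrite AA' => -[z' Az' /(mulIr ubV)/injiota <-].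
  by move=> A A' _ _ E; apply/seteqP; split; exact: sub.
- move=> _ [C [ulC KC] <-]; have [t uC] := ulrich_with_of_ideal locB nb regb ulC.
  have preC : num @^-1` I `<=` C.
    move=> x Ix; have : ideal_frac iota I b (inB x) by rewrite fracE //; exists x.
    by move=> /KC[y Cy /val_inj <-].
  have [CK|nCK] := EM (C `<=` num @^-1` I).
    exists (ideal_set I); first by split.
    by rewrite /= fracE //; congr image; apply/seteqP.
  have [e uA] := image_ulrich locR nm idJ Jm uI IJ nJI (uw_nonprincipal uJ) uC preC nCK.
  have AJ : num @` C `<=` ideal_set J by move=> _ [x _ <-]; exact: (nm_in nm).
  exists (num @` C).
    split; first exact (ulrich_ideal_of_with locR dimR uA).
      move=> i Ii; have [x xE] := nm_onto nm (IJ _ Ii).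
      by exists x => //; apply: preC; rewrite /= xE.
    split=> // /(_ b Jb)[x Cx]; rewrite -(nm_1 nm) => /(nm_inj nm) x1.
    by apply: (local_proper locB); apply: (uw_sub uC); rewrite -x1.
  rewrite /= fracE //; congr image; apply/seteqP; split=> [x [y Cy /(nm_inj nm) <-] //|x Cx].
  by exists x.
Qed.
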